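(* Let $X\subset\mathbb{R}^p$ be compact, $\mathcal{U}=L^2(X)$ with inner product $\langle\cdot,\cdot\rangle$, and let $\varphi^t$ be the continuous flow generated by $$\dot u = W(u)=\sum_{i=1}^n c_i W_i(u),\qquad c_i\in\mathbb{R},$$ where $W_i:\mathcal{D}(W_i)\to\mathcal{U}$ are (possibly nonlinear) operators and $W_1(u)=u$ (possibly with $c_1=0$). Let $\overline{\mathcal{U}}\subset\mathcal{D}(W)$ be invariant under $\varphi^t$, let $w\in L^2(X)$, and let $\mathcal{E}_n\subset\mathcal{D}(L)$ be the subspace spanned by the basis functionals $\zeta_i(\cdot)=\langle W_i(\cdot),w\rangle\in C(\overline{\mathcal{U}})$, $i=1,\dots,n$, so that $\zeta_1(\cdot)=\langle\cdot,w\rangle$. Here $L$ is the Lie generator of the Koopman semigroup associated with $\varphi^t$. Assume that the pairs $(u_k,\varphi^{t_s}(u_k))\in\overline{\mathcal{U}}^2$, $k=1,\dots,m$, are such that the $n\le m$ vectors $(\zeta_i(u_1),\dots,\zeta_i(u_m))$, $i=1,\dots,n$, are linearly independent. Let $$\widetilde{\mathbf{L}}^{(t_s)}=\frac{1}{t_s}\log\left(\mathbf{\Theta}_1^\dagger\mathbf{\Theta}_2\right),$$ where $\mathbf{\Theta}_1,\mathbf{\Theta}_2$ are the $m\times n$ matrices with entries $(\mathbf{\Theta}_1)_{ki}=\zeta_i(u_k)$ and $(\mathbf{\Theta}_2)_{ki}=\zeta_i(\varphi^{t_s}(u_k))$. Then, for every $i=1,\dots,n$, $$\lim_{t_s\to0}\widetilde{\mathbf{L}}^{(t_s)}_{i1}=c_i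 .$$
   Context: Functions in $L^2(X)$ are real-valued. The operator $W:\mathcal{D}(W)\to\mathcal{U}$ generates a (possibly nonlinear) semiflow $(\varphi^t)_{t\ge0}$ of maps $\varphi^t:\mathcal{U}\to\mathcal{U}$: for every initial condition $u_0\in\mathcal{D}(W)$, $u(t)=\varphi^t(u_0)$ is a classical solution of $\dot u=W(u)$, $u(0)=u_0$. Standing assumptions: each map $\varphi^t:\mathcal{U}\to\mathcal{U}$, $t\ge0$, is continuous, and for each $u$ the map $t\mapsto\varphi^t(u)$ is continuous from $\mathbb{R}^+$ into $\mathcal{U}$. $\mathcal{E}=C(\overline{\mathcal{U}})$ denotes the space of bounded continuous complex-valued functionals on $\overline{\mathcal{U}}$ with the supremum norm. In particular, the assumption $\zeta_i\in C(\overline{\mathcal{U}})$ includes that $W_i$ is defined on $\overline{\mathcal{U}}$. The Koopman semigroup is $K^t\zeta=\zeta\circ\varphi^t$ for $\zeta\in\mathcal{E}$, $t\ge0$. Its Lie generator is the linear operator $L:\mathcal{D}(L)\to\mathcal{E}$ defined pointwise by $$L\zeta(u)=\lim_{t\downarrow0}\frac{K^t\zeta(u)-\zeta(u)}{t}\quad\text{for all }u\in\overline{\mathcal{U}},\ \zeta\in\mathcal{D}(L),$$ where $\mathcal{D}(L)$ consists of those $\zeta\in\mathcal{E}$ for which this limit exists for every $u\in\overline{\mathcal{U}}$ and defines an element of $\mathcal{E}$. $\mathbf{\Theta}^\dagger$ is the Moore-Penrose pseudoinverse and $\log$ is the principal matrix logarithm. The points $u_1,\dots,u_m$ are fixed,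 and the sampling time $t_s>0$ tends to $0$; $\widetilde{\mathbf{L}}^{(t_s)}$ is considered for $t_s$ small enough that the logarithm is defined. $\widetilde{\mathbf{L}}^{(t_s)}_{i1}$ is the $(i,1)$ entry. *)

(* Defs.v *)
From HB Require Import structures.
From mathcomp Require Import all_boot all_order all_algebra.
From mathcomp Require Import complex spectral.
From mathcomp Require Import all_classical all_reals all_analysis measurable_realfun.
From mathcomp Require Import ring lra.

Set Implicit Arguments.
Unset Strict Implicit.
Unset Printing Implicit Defensive.

Import Order.TTheory GRing.Theory Num.Theory.
Import numFieldTopology.Exports numFieldNormedType.Exports.

Local Open Scope classical_set_scope.
Local Open Scope ring_scope.
Local Open Scope sesquilinear_scope.

Section lebesgue_rV.
Variables (R : realType) (p : nat).
Local Notation V := 'rV[R]_p.+1.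
Local Open Scope ereal_scope.

(* Outer measure of A: infimum of the total volumes of the countable covers of A
   by half-open boxes.  The dimension is p.+1 >= 1: a box of R^0 is never
   empty. *)
Definition box (a b : V) : set V :=
  [set x | forall i, (a ord0 i < x ord0 i <= b ord0 i)%R].

Definition box_vol (a b : V) : \bar R :=
  (\prod_i Num.max 0 (b ord0 i - a ord0 i))%R%:E.

Definition box_cover (A : set V) : set (nat -> V * V) :=
  [set B | A `<=` \bigcup_k box (B k).1 (B k).2].

Definition lebesgue_outer (A : set V) : \bar R :=
  ereal_inf [set \sum_(k <oo) box_vol (B k).1 (B k).2 | B in box_cover A].

Lemma box_vol_ge0 a b : 0 <= box_vol a b.
Proof. by rewrite lee_fin; apply: prodr_ge0 => i _; rewrite le_max lexx. Qed.

#[local] Hint Resolve box_vol_ge0 : core.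

Lemma lebesgue_outer_ge0 A : 0 <= lebesgue_outer A.
Proof. by apply: le_ereal_inf_tmp => x [B AB <-]; exact: nneseries_ge0. Qed.

#[local] Hint Resolve lebesgue_outer_ge0 : core.

Lemma lebesgue_outer0 : lebesgue_outer set0 = 0.
Proof.
apply/eqP; rewrite eq_le lebesgue_outer_ge0 andbT.
apply: ereal_inf_lbound; exists (fun=> (0%R, 0%R)); first by move=> x [].
apply: eseries0 => k _ _.
by rewrite /box_vol big_ord_recl subrr maxxx mul0r.
Qed.

Lemma le_lebesgue_outer : {homo lebesgue_outer : A B / A `<=` B >-> A <= B}.
Proof.
move=> A B AB; apply/ereal_inf_le_tmp => x [B' BB' <-].
by exists B' => //; exact: subset_trans AB BB'.
Qed.

Lemma lebesgue_outer_sigma_subadditive : sigma_subadditive lebesgue_outer.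
Proof.
move=> A; have [[i ioo]|] := pselect (exists i, lebesgue_outer (A i) = +oo).
  rewrite (eseries_pinfty _ _ ioo) ?leey// => n _.
  by rewrite -ltNye (lt_le_trans _ (lebesgue_outer_ge0 _)).
rewrite -forallNE => Aoo.
suff add2e (e : {posnum R}) : lebesgue_outer (\bigcup_n A n) <=
    \sum_(i <oo) lebesgue_outer (A i) + e%:num%:E.
  by apply/lee_addgt0Pr => _/posnumP[].
rewrite (le_trans _ (epsilon_trick _ _ _))//.
pose P n (B : nat -> V * V) := box_cover (A n) B /\
  \sum_(k <oo) box_vol (B k).1 (B k).2 <=
    lebesgue_outer (A n) + (e%:num / (2 ^ n.+1)%:R)%:E.
have [G PG] : {G : nat -> nat -> V * V & forall n, P n (G n)}.
  apply: (@choice _ _ P) => n; rewrite /P.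
  have fA : lebesgue_outer (A n) \is a fin_num.
    rewrite ge0_fin_numE//; have := Aoo n.
    by rewrite ltey => /eqP.
  have en1 : (0 < e%:num / (2 ^ n.+1)%:R)%R by [].
  have [x [B AnB muBx] xS] := lb_ereal_inf_adherent en1 fA.
  by exists B; split => //; rewrite muBx; exact/ltW.
pose vG ij := box_vol (G ij.1 ij.2).1 (G ij.1 ij.2).2.
have vG_ge0 ij : 0 <= vG ij by exact: box_vol_ge0.
apply: (@le_trans _ _ (\esum_(i in setT) vG i)).
  apply: ereal_inf_lbound => /=.
  have /card_esym/ppcard_eqP[f] := card_nat2.
  exists (fun n => G (f n).1 (f n).2).
    move=> t [i _] /(PG i).1[j _ ?]; exists (f^-1%FUN (i, j)) => //=.
    by rewrite invK ?inE.
  rewrite -(esum_pred_image vG f xpredT) ?[fun=> _]set_true//.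
  by rewrite image_eq.
rewrite (_ : esum _ _ = \sum_(i <oo) \sum_(j <oo) vG (i, j)); last first.
  pose J : nat -> set (nat * nat) := fun i => [set (i, j) | j in setT].
  rewrite (_ : setT = \bigcup_k J k); last first.
    by rewrite predeqE => -[a b]; split => // _; exists a => //; exists b.
  rewrite esum_bigcupT //=; last first.
    apply/trivIsetP => i j _ _ ij.
    rewrite predeqE => -[n m] /=; split => //= -[] [_] _ [<-{n} _].
    by move=> [m' _] [] /esym/eqP; rewrite (negbTE ij).
  rewrite -(image_id [set: nat]) -fun_true esum_pred_image//; last first.
    by move=> n _; exact: esum_ge0.
  apply: eq_eseriesr => /= j _.
  rewrite -(esum_pred_image vG (pair j) predT)//=; last first.
    by move=> ? ? _ _; exact: (@can_inj _ _ _ snd).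
  by congr esum; rewrite predeqE => -[a b]; split; move=> [i _ <-]; exists i.
apply: lee_lim.
- by apply: is_cvg_nneseries => n *; exact: nneseries_ge0.
- by apply: is_cvg_nneseries => n *; apply: adde_ge0.
- by near=> n; apply: lee_sum => i _; exact: (PG i).2.
Unshelve. all: by end_near. Qed.

HB.instance Definition _ := isOuterMeasure.Build R V lebesgue_outer
  lebesgue_outer0 lebesgue_outer_ge0 le_lebesgue_outer
  lebesgue_outer_sigma_subadditive.

Definition lebesgue_outer_measure : {outer_measure set V -> \bar R} :=
  lebesgue_outer.

(* R^(p.+1) with the sigma-algebra of Lebesgue (Caratheodory) measurable
   sets. *)
Definition lebesgue_space := caratheodory_type lebesgue_outer_measure.

HB.instance Definition _ := Measurable.on lebesgue_space.

Definition lebesgue_rV : {measure set lebesgue_space -> \bar R} :=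
  [the measure _ _ of
    (lebesgue_outer_measure : set (caratheodory_type lebesgue_outer_measure) -> \bar R)].

Local Notation halfspace i c := [set x : V | (x ord0 i <= c)%R].

Lemma measurable_halfspace i c :
  measurable (halfspace i c : set lebesgue_space).
Proof.
apply: le_caratheodory_measurable => X /=.
apply: le_ereal_inf_tmp => _ [B XB <-].
pose b1 k : V := \row_j if j == i then Num.min ((B k).2 ord0 j) c else (B k).2 ord0 j.
pose a2 k : V := \row_j if j == i then Num.max ((B k).1 ord0 j) c else (B k).1 ord0 j.
rewrite (_ : \sum_(k <oo) box_vol (B k).1 (B k).2 =
  \sum_(k <oo) (box_vol (B k).1 (b1 k) + box_vol (a2 k) (B k).2)); last first.
  apply: eq_eseriesr => k _; rewrite /box_vol -EFinD; congr EFin.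
  have volE (a b : V) : (\prod_j Num.max 0 (b ord0 j - a ord0 j) =
      Num.max 0 (b ord0 i - a ord0 i) *
      \prod_(j | j != i) Num.max 0 (b ord0 j - a ord0 j))%R by rewrite (bigD1 i).
  rewrite !volE !mxE eqxx.
  under [in RHS]eq_bigr => j ji do rewrite mxE (negbTE ji).
  under [X in (_ + _ * X)%R]eq_bigr => j ji do rewrite mxE (negbTE ji).
  rewrite -mulrDl; congr (_ * _)%R.
  set a := (B k).1 ord0 i; set b := (B k).2 ord0 i.
  by case: (leP b c) => bc; case: (leP a c) => ac;
    rewrite /Num.max; repeat case: ifP => ?; lra.
rewrite nneseriesD => [|j _ _|j _ _]; [|exact: box_vol_ge0..].
apply: leeD; apply: ereal_inf_lbound.
- exists (fun k => ((B k).1, b1 k)) => // x [/XB[k _ Bx] xc].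
  exists k => //= j; have := Bx j; rewrite mxE; case: eqP => [->|//].
  by rewrite le_min => /andP[-> ->].
- exists (fun k => (a2 k, (B k).2)) => // x [/XB[k _ Bx] /negP].
  rewrite -ltNge => xc.
  exists k => //= j; have := Bx j; rewrite mxE; case: eqP => [->|//].
  by rewrite gt_max => /andP[-> ->]; rewrite xc.
Qed.

Lemma measurable_box a b : measurable (box a b : set lebesgue_space).
Proof.
rewrite (_ : box a b = \bigcap_(i in [set: 'I_p.+1])
  (halfspace i (b ord0 i) `&` ~` halfspace i (a ord0 i))).
  apply: fin_bigcap_measurable => // i _.
  by apply: measurableI; [|apply: measurableC]; exact: measurable_halfspace.
apply/seteqP; split => x /=.
  by move=> xab i _; have /andP[ax xb] := xab i; split=> //; apply/negP; rewrite -ltNge.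
by move=> xab i; have [xb /negP] := xab i I; rewrite -ltNge => ->.
Qed.

Lemma open_lebesgue_measurable (A : set V) :
  open A -> measurable (A : set lebesgue_space).
Proof.
move=> oA.
pose rbox (q : 'rV[rat]_p.+1 * 'rV[rat]_p.+1) : set lebesgue_space :=
  let B := box (map_mx ratr q.1) (map_mx ratr q.2) in
  if `[< B `<=` A >] then B else set0.
rewrite (_ : A = \bigcup_q rbox q).
  apply: countable_bigcupT_measurable => // q; rewrite /rbox.
  by case: ifP => _; [exact: measurable_box | exact: measurable0].
apply/seteqP; split=> [x Ax|x [q _]]; last first.
  by rewrite /rbox; case: asboolP => [BA /BA|].
have /nbhs_ballP[e /= e0 xeA] : nbhs x A by exact: open_nbhs_nbhs.
have /choice[qa qaP] : forall i, exists q : rat,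
    (x ord0 i - e < ratr q < x ord0 i)%R.
  move=> i; have /rat_in_itvoo[q] : (x ord0 i - e < x ord0 i)%R by rewrite ltrBlDr ltrDl.
  by rewrite in_itv; exists q.
have /choice[qb qbP] : forall i, exists q : rat,
    (x ord0 i < ratr q < x ord0 i + e)%R.
  move=> i; have /rat_in_itvoo[q] : (x ord0 i < x ord0 i + e)%R by rewrite ltrDl.
  by rewrite in_itv; exists q.
exists (\row_i qa i, \row_i qb i) => //; rewrite /rbox; case: asboolP => [_ i|].
  by rewrite !mxE; have /andP[_ ->] := qaP i; have /andP[/ltW -> _] := qbP i.
case=> y yB; apply: xeA; split=> // i j; rewrite ord1 -ball_normE/= ltr_norml.
have := yB j; rewrite !mxE => /andP[ay yb].
have /andP[xa _] := qaP j; have /andP[_ bx] := qbP j.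
by apply/andP; split; lra.
Qed.

Lemma compact_lebesgue_measurable (X : set V) :
  compact X -> measurable (X : set lebesgue_space).
Proof.
move=> cX; rewrite -[X]setCK; apply: measurableC; apply: open_lebesgue_measurable.
by rewrite openC; apply: compact_closed => //; exact: norm_hausdorff.
Qed.

End lebesgue_rV.

Section L2.
Context d (T : measurableType d) (R : realType).
Variable mu : {measure set T -> \bar R}.
Local Open Scope quotient_scope.

(* The library's quotient type of square-integrable functions modulo a.e.
   equality comes without algebraic or topological structure; it is made here
   a normed vector space over R. *)
Definition L2 : Type := LspaceType2 mu.

Definition L2_fun (u : L2) : T -> R := LebesgueSpace.sort u.

Let Lfun2 := Lfun mu 2%:E.

Lemma L2_funP (u : L2) : L2_fun u \in Lfun2.
Proof.
apply/andP; split; rewrite inE; first exact: (@measurable_funPT _ _ T (measurableTypeR R)).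
exact: (@Lebesgue_finite _ _ _ _ _ _ u).
Qed.

Lemma Lfun2_measurable (f : T -> R) : f \in Lfun2 -> measurable_fun setT f.
Proof. by move=> /andP[]; rewrite inE. Qed.

Lemma ae_eq_Lnorm2 (f g : T -> R) : measurable_fun setT f ->
  measurable_fun setT g -> f = g %[ae mu] ->
  ('N[mu]_(2%:R)%:E[EFin \o f] = 'N[mu]_(2%:R)%:E[EFin \o g])%E.
Proof.
move=> mf mg fg; rewrite unlock /=; congr (_ `^ _)%E.
apply: ae_eq_integral => //.
- apply/measurable_EFinP; apply: (@measurableT_comp _ _ _ _ _ _ (@powR R ^~ 2%:R)) => //=; exact: measurableT_comp.
- apply/measurable_EFinP; apply: (@measurableT_comp _ _ _ _ _ _ (@powR R ^~ 2%:R)) => //=; exact: measurableT_comp.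
- by apply: filterS fg => x /= /[apply] ->.
Qed.

Section class.
Variables (f : T -> R) (fP : f \in Lfun2).

Let f0 : T -> measurableTypeR R := f.
#[local] HB.instance Definition _ :=
  isMeasurableFun.Build _ _ T (measurableTypeR R) f0 (Lfun2_measurable fP).
Let f' : {mfun T >-> measurableTypeR R} := f0.

Let pif : {mfun_ mu, T >-> measurableTypeR R} := \pi f'.

Lemma L2_pifE : (pif : T -> R) = f %[ae mu].
Proof.
have : repr pif == f' %[mod {mfun_ mu, T >-> measurableTypeR R}].
  by rewrite reprK.
by rewrite eqmodE => /asboolP.
Qed.

Lemma L2_pif_fin : finite_norm mu (2%:R)%:E (pif : T -> R).
Proof.
rewrite /finite_norm (ae_eq_Lnorm2 _ _ L2_pifE).
- by have /andP[_] := fP; rewrite inE.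
- exact: (@measurable_funPT _ _ T (measurableTypeR R)).
- exact: Lfun2_measurable.
Qed.

Definition L2_class : L2 :=
  LebesgueSpace.Pack (LebesgueSpace.Class
    (isFinLebesgue.Axioms_ _ _ _ _ (lee1n 2) pif L2_pif_fin)).

Lemma L2_classE : L2_fun L2_class = f %[ae mu].
Proof. exact: L2_pifE. Qed.

End class.

Lemma L2P (u v : L2) : L2_fun u = L2_fun v %[ae mu] -> u = v.
Proof.
case: u => u [[uf]]; case: v => v [[vf]]; rewrite /L2_fun/= => uv.
have {}uv : u = v.
  apply/eqP; rewrite -[u]reprK -[v]reprK; apply/eqP/eqmodP; rewrite /=.
  exact/asboolP.
by case: _ / uv vf => vf; rewrite (Prop_irrelevance uf vf).
Qed.

HB.instance Definition _ := gen_eqMixin L2.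
HB.instance Definition _ := gen_choiceMixin L2.

Definition L2_Lfun (u : L2) : LfunType mu (lee1n 2) := Lfun_Sub (lee1n 2) (L2_funP u).

Definition L2_zero := L2_class (LfunP (0 : LfunType mu (lee1n 2))).
Definition L2_opp u := L2_class (LfunP (- L2_Lfun u)).
Definition L2_add u v := L2_class (LfunP (L2_Lfun u + L2_Lfun v)).
Definition L2_scale a u := L2_class (LfunP (a *: L2_Lfun u)).

Lemma L2_oppE u : L2_fun (L2_opp u) = - L2_fun u %[ae mu].
Proof. exact: L2_classE. Qed.
Lemma L2_addE u v : L2_fun (L2_add u v) = L2_fun u + L2_fun v %[ae mu].
Proof. exact: L2_classE. Qed.
Lemma L2_scaleE a u : L2_fun (L2_scale a u) = a *: L2_fun u %[ae mu].
Proof. exact: L2_classE. Qed.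
Lemma L2_zeroE : L2_fun L2_zero = 0 %[ae mu].
Proof. exact: L2_classE. Qed.

Lemma L2_filterS4 (P1 P2 P3 P4 Q : set T) :
  (forall x, P1 x -> P2 x -> P3 x -> P4 x -> Q x) ->
  (\forall x \near almost_everywhere mu, P1 x) -> (\forall x \near almost_everywhere mu, P2 x) ->
  (\forall x \near almost_everywhere mu, P3 x) -> (\forall x \near almost_everywhere mu, P4 x) ->
  \forall x \near almost_everywhere mu, Q x.
Proof.
move=> PQ p1 p2 p3 p4; apply: filterS2 (filterI p1 p2) (filterI p3 p4).
by move=> x [? ?] [? ?]; exact: PQ.
Qed.

Lemma L2_addA : associative L2_add.
Proof.
move=> u v w; apply: L2P.
have := L2_addE u (L2_add v w); have := L2_addE (L2_add u v) w.
have := L2_addE u v; have := L2_addE v w.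
apply: L2_filterS4 => x /= /(_ I) h1 /(_ I) h2 /(_ I) h3 /(_ I) h4 _.
by rewrite h4 h3 !fctE h1 h2 !fctE addrA.
Qed.

Lemma L2_addC : commutative L2_add.
Proof.
move=> u v; apply: L2P; have := L2_addE u v; have := L2_addE v u.
apply: filterS2 => x /= /(_ I) h1 /(_ I) h2 _.
by rewrite h1 h2 !fctE addrC.
Qed.

Lemma L2_add0 : left_id L2_zero L2_add.
Proof.
move=> u; apply: L2P; have := L2_addE L2_zero u; have := L2_zeroE.
apply: filterS2 => x /= /(_ I) h1 /(_ I) h2 _.
by rewrite h2 !fctE h1 add0r.
Qed.

Lemma L2_addN : left_inverse L2_zero L2_opp L2_add.
Proof.
move=> u; apply: L2P; have := L2_addE (L2_opp u) u; have := L2_zeroE; have := L2_oppE u.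
apply: filterS3 => x /= /(_ I) h1 /(_ I) h2 /(_ I) h3 _.
by rewrite h3 !fctE h1 h2 !fctE addNr.
Qed.

HB.instance Definition _ := GRing.isZmodule.Build L2 L2_addA L2_addC L2_add0 L2_addN.

Lemma L2_funN u : L2_fun (- u) = - L2_fun u %[ae mu].
Proof. exact: L2_oppE. Qed.

Lemma L2_funD u v : L2_fun (u + v) = L2_fun u + L2_fun v %[ae mu].
Proof. exact: L2_addE. Qed.

Lemma L2_fun0 : L2_fun 0 = 0 %[ae mu].
Proof. exact: L2_zeroE. Qed.

Lemma L2_scaleA a b u : L2_scale a (L2_scale b u) = L2_scale (a * b) u.
Proof.
apply: L2P; have := L2_scaleE a (L2_scale b u); have := L2_scaleE b u.
have := L2_scaleE (a * b) u.
apply: filterS3 => x /= /(_ I) h1 /(_ I) h2 /(_ I) h3 _.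
by rewrite h3 h1 /= !fctE h2 scalerA.
Qed.

Lemma L2_scale1 : left_id 1 L2_scale.
Proof.
move=> u; apply: L2P; have := L2_scaleE 1 u.
by apply: filterS => x /= /(_ I) h1 _; rewrite h1 scale1r.
Qed.

Lemma L2_scaleDr : right_distributive L2_scale +%R.
Proof.
move=> a u v; apply: L2P.
have := L2_scaleE a (u + v); have := L2_funD u v.
have := L2_funD (L2_scale a u) (L2_scale a v).
have : \forall x \near almost_everywhere mu,
    L2_fun (L2_scale a u) x = a *: L2_fun u x /\ L2_fun (L2_scale a v) x = a *: L2_fun v x.
  by have := L2_scaleE a u; have := L2_scaleE a v; apply: filterS2 => x /(_ I) h /(_ I).
apply: L2_filterS4 => x /= [h2 h1] /(_ I) h3 /(_ I) h4 /(_ I) h5 _.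
by rewrite h5 h3 !fctE h4 h1 h2 !fctE scalerDr.
Qed.

Lemma L2_scaleDl u : {morph L2_scale^~ u : a b / a + b}.
Proof.
move=> a b; apply: L2P.
have := L2_scaleE (a + b) u; have := L2_funD (L2_scale a u) (L2_scale b u).
have := L2_scaleE a u; have := L2_scaleE b u.
apply: L2_filterS4 => x /= /(_ I) h1 /(_ I) h2 /(_ I) h3 /(_ I) h4 _.
by rewrite h4 h3 !fctE h1 h2 !fctE scalerDl.
Qed.

HB.instance Definition _ :=
  GRing.Zmodule_isLmodule.Build R L2 L2_scaleA L2_scale1 L2_scaleDr L2_scaleDl.

Lemma L2_funZ a u : L2_fun (a *: u) = a *: L2_fun u %[ae mu].
Proof. exact: L2_scaleE. Qed.

Definition L2_dot (u v : L2) : R := \int[mu]_x (L2_fun u x * L2_fun v x).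

Definition L2_norm (u : L2) : R := fine 'N[mu]_(2%:R)%:E[EFin \o L2_fun u]%E.

Lemma measurable_L2_fun u : measurable_fun setT (L2_fun u).
Proof. exact/Lfun2_measurable/L2_funP. Qed.

Lemma L2_normD u v : L2_norm (u + v) <= L2_norm u + L2_norm v.
Proof.
rewrite {1}/L2_norm (ae_eq_Lnorm2 _ _ (L2_funD u v)).
- exact: (ler_LnormD (L2_Lfun u) (L2_Lfun v)).
- exact: measurable_L2_fun.
- by apply: measurable_funD; exact: measurable_L2_fun.
Qed.

Lemma L2_normZ a u : L2_norm (a *: u) = `|a| * L2_norm u.
Proof.
rewrite {1}/L2_norm (ae_eq_Lnorm2 _ _ (L2_funZ a u)).
- rewrite (_ : 'N[_]__[_]%E = `|a|%:E * 'N[mu]_(2%:R)%:E[EFin \o L2_fun u])%E.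
    by rewrite -(finite_norm_fine (L2_Lfun u)).
  exact: (LnormZ (L2_Lfun u) a).
- exact: measurable_L2_fun.
- by apply: measurable_funM => //; exact: measurable_L2_fun.
Qed.

Lemma L2_norm_eq0 u : L2_norm u = 0 -> u = 0.
Proof.
move=> /(@fine_Lnormr_eq0 _ _ _ _ _ _ (L2_Lfun u)) u0; apply: L2P.
have := L2_fun0; apply: filterS2 u0 => x /= /(_ I) h1 /(_ I) h2 _.
by rewrite h1 h2.
Qed.

HB.instance Definition _ := Lmodule_isNormed.Build R L2 L2_normD L2_normZ L2_norm_eq0.

End L2.

(* L^2(X): classes of functions modulo equality a.e. on X, for the Lebesgue
   measure restricted to X. *)
Definition L2_on (R : realType) (p : nat) (X : set 'rV[R]_p.+1)
    (cX : compact X) :=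
  L2 (mrestr (lebesgue_rV R p) (compact_lebesgue_measurable cX)).

(* R[i] seen as a numClosedFieldType, from which it gets its topology. *)
Definition Cplx (R : realType) : numClosedFieldType := R[i].

Section koopman.
Variables (R : realType) (U : normedModType R).
Local Notation C := (Cplx R).
Implicit Types (phi : R -> U -> U) (A : set U) (z : U -> C).

Definition semiflow phi :=
  [/\ forall u, phi 0 u = u,
      forall (s t : R) u, 0 <= s -> 0 <= t -> phi (s + t) u = phi s (phi t u),
      forall t : R, 0 <= t -> continuous (phi t)
    & forall u, {within [set t : R | 0 <= t], continuous (fun t : R => phi t u)}].

(* Classical solution on [0, +oo[ of x' = W x, x 0 = x0: a C^1 curve in D
   (D is the domain of W), the derivative at 0 being one-sided. *)
Definition classical_solution (D : set U) (W : U -> U) (x : R -> U) (x0 : U) :=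
  [/\ x 0 = x0,
      forall t : R, 0 <= t -> D (x t),
      forall t : R, 0 <= t ->
        (s - t)^-1 *: (x s - x t) @[s --> within [set s : R | 0 <= s] t^']
          --> W (x t)
    & {within [set t : R | 0 <= t], continuous (fun t : R => W (x t))}].

Definition generates (D : set U) (W : U -> U) phi :=
  forall u0, D u0 -> classical_solution D W (fun t => phi t u0) u0.

Definition flow_invariant phi A :=
  forall (t : R) u, 0 <= t -> A u -> A (phi t u).

(* A function on A is represented by a function on U, whose values outside A
   are irrelevant. *)
Definition Cb A : set (U -> C) :=
  [set z | {within A, continuous z} /\ [bounded z u | u in A]].

Definition koopman phi (t : R) z : U -> C := z \o phi t.

Definition lie_quotient phi z (u : U) (t : R) : C :=
  ((t%:C)%C : C)^-1 * (koopman phi t z u - z u).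

Definition lie_generator phi z (u : U) : C :=
  lim (lie_quotient phi z u t @[t --> 0^'+]).

Definition lie_domain phi A : set (U -> C) :=
  [set z | [/\ Cb A z,
              forall u, A u -> cvg (lie_quotient phi z u t @[t --> 0^'+])
            & Cb A (lie_generator phi z)]].

Definition span_on A (n : nat) (zeta : 'I_n -> U -> C) : set (U -> C) :=
  [set z | exists a : 'I_n -> C, forall u, A u -> z u = \sum_i a i * zeta i u].

End koopman.

Section matrices.
Variable R : realType.
Local Notation C := (Cplx R).

Definition is_mp_inverse (m n : nat) (A : 'M[C]_(m, n)) (B : 'M[C]_(n, m)) :=
  [/\ A *m B *m A = A, B *m A *m B = B,
      (A *m B)^t* = A *m B & (B *m A)^t* = B *m A].

(* The four Penrose conditions have exactly one solution. *)
Definition mp_inverse (m n : nat) (A : 'M[C]_(m, n)) : 'M[C]_(n, m) :=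
  xget 0 [set B | is_mp_inverse A B].

Definition expm (n : nat) (A : 'M[C]_n.+1) : 'M[C]_n.+1 :=
  limn (series (fun k => (k`!%:R : C)^-1 *: A ^+ k)).

Definition is_principal_log (n : nat) (A B : 'M[C]_n.+1) :=
  expm B = A /\
  forall z : C, eigenvalue B z -> - pi < complex.Im z < pi.

(* The principal logarithm is unique; junk value 0 if A has none. *)
Definition logm (n : nat) (A : 'M[C]_n.+1) : 'M[C]_n.+1 :=
  xget 0 [set B | is_principal_log A B].

Definition data_matrix (U : Type) (m n : nat) (zeta : 'I_n -> U -> C)
    (u : 'I_m -> U) : 'M[C]_(m, n) :=
  \matrix_(k, i) zeta i (u k).

End matrices.

Section lifting.
Variables (R : realType) (U : normedModType R) (m n : nat).
Local Notation C := (Cplx R).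
Variables (phi : R -> U -> U) (zeta : 'I_n.+1 -> U -> C) (u : 'I_m -> U).

Definition koopman_matrix (ts : R) : 'M[C]_n.+1 :=
  mp_inverse (data_matrix zeta u) *m data_matrix zeta (fun k => phi ts (u k)).

Definition generator_matrix (ts : R) : 'M[C]_n.+1 :=
  ((ts%:C)%C : C)^-1 *: logm (koopman_matrix ts).

End lifting.

(* The functional v |-> <W v, w> on L^2(X), with values seen in C. *)
Definition observable (R : realType) (p : nat) (X : set 'rV[R]_p.+1)
    (cX : compact X) (W : L2_on cX -> L2_on cX) (w : L2_on cX)
    (v : L2_on cX) : Cplx R :=
  ((L2_dot (W v) w)%:C)%C.

(* Main.v *)
Require Import Defs.
From HB Require Import structures.
From mathcomp Require Import all_boot all_order all_algebra.
From mathcomp Require Import complex spectral.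
From mathcomp Require Import all_classical all_reals all_analysis measurable_realfun.
From mathcomp Require Import ring lra.

(** Write [A(t)] for the Koopman matrix [Theta1^+ Theta2(t)].  As [Theta1] has
    full column rank, [Theta1^+ Theta1 = 1], so that [A(t) = 1 + E(t)] with
    [E(t) = Theta1^+ (Theta2(t) - Theta1)].  The span of the observables lies
    in the domain of the Lie generator [L], hence [(Theta2(t) - Theta1) / t]
    tends to the matrix [Lam] of the values [L zeta_i (u_k)], and [E(t) / t]
    tends to [M = Theta1^+ Lam].  Since [zeta_0 = <., w>] is continuous and
    linear and the trajectories solve the evolution equation,
    [L zeta_0 = <W(.), w> = \sum_i c_i zeta_i] on the data: the first column of
    [Lam] is [Theta1 c], and that of [M] is [Theta1^+ Theta1 c = c].

    It remains to see that [log (1 + E(t)) / t] has the same limit as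
    [E(t) / t], for which [log (1 + E) = E + O(|E|^2)] is enough
    ([logm_near1], [log_derivative]).  Two facts give this estimate.

    Existence ([expm_near1]): [exp B = 1 + E] is the fixed-point equation
    [B = E - (exp B - 1 - B)], whose right-hand side is a contraction near [0].
    The iteration started at [0] converges to a solution with
    [|B - E| <= 8 |E|^2], which commutes with every matrix commuting with [E];
    its eigenvalues are small, hence [B] is a principal logarithm.

    Uniqueness ([principal_log_unique]): let [B] and [B'] be commuting
    principal logarithms of one matrix and suppose that [N = B - B'] is not 0.
    The row space of [N] is stable under [B] and [B'], so that it contains a
    common eigenvector [w = y N], with eigenvalues [l] and [l'].  From
    [exp B = exp B'] follows [e^l = e^l'], and then [l = l'] because both lie
    in the strip [|Im z| < pi].  Expanding [B^k - B'^k] in powers of [B] and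
    [B'] then gives [y (exp B - exp B') = e^l w], which is not 0: a
    contradiction.  Any principal logarithm [L] of [1 + E] commutes with
    [1 + E = exp L], hence with the [B] above, hence equals [B]. *)

Import Order.TTheory GRing.Theory Num.Theory.
Import numFieldTopology.Exports numFieldNormedType.Exports.

Local Open Scope classical_set_scope.
Local Open Scope ring_scope.

Set Implicit Arguments.
Unset Strict Implicit.
Unset Printing Implicit Defensive.

(** * A submultiplicative norm on complex matrices *)

Section norm.
Variable R : realType.
Local Notation C := (Cplx R).

(** The modulus of a complex number, as an element of [R]: the order of [C] is
    only partial, so that estimates are better stated in [R]. *)
Definition cnorm (z : C) : R := Normc.normc z.

Lemma cnormE (z : C) : `|z| = ((cnorm z)%:C)%C.
Proof. by []. Qed.

Lemma cnorm_ge0 (z : C) : 0 <= cnorm z.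
Proof. by rewrite -ler0c -cnormE normr_ge0. Qed.

Lemma cnormD (z w : C) : cnorm (z + w) <= cnorm z + cnorm w.
Proof. exact: le_normcD. Qed.

Lemma cnormM (z w : C) : cnorm (z * w) = cnorm z * cnorm w.
Proof. exact: Normc.normcM. Qed.

Lemma cnormN (z : C) : cnorm (- z) = cnorm z.
Proof. exact: normcN. Qed.

Lemma cnorm0 : cnorm 0 = 0.
Proof. exact: Normc.normc0. Qed.

Lemma cnorm1 : cnorm 1 = 1.
Proof. exact: Normc.normc1. Qed.

Lemma cnorm0_eq0 (z : C) : cnorm z = 0 -> z = 0.
Proof. exact: Normc.eq0_normc. Qed.

Lemma cnormX (z : C) k : cnorm (z ^+ k) = cnorm z ^+ k.
Proof.
by elim: k => [|k IH]; rewrite ?expr0 ?cnorm1// !exprS cnormM IH.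
Qed.

Lemma cnormV (z : C) : cnorm z^-1 = (cnorm z)^-1.
Proof. exact: Normc.normcV. Qed.

Lemma cnormr (x : R) : cnorm (x%:C)%C = `|x|.
Proof. by rewrite /cnorm /= expr0n /= addr0 sqrtr_sqr. Qed.

Lemma cnorm_nat k : cnorm k%:R = k%:R.
Proof.
rewrite (_ : k%:R = ((k%:R : R)%:C)%C) ?cnormr ?ger0_norm//.
by rewrite rmorph_nat.
Qed.

Lemma cnorm_Re (z : C) : `|complex.Re z| <= cnorm z.
Proof.
by case: z => a b; rewrite /cnorm /= -sqrtr_sqr ler_wsqrtr// lerDl sqr_ge0. Qed.

Lemma cnorm_Im (z : C) : `|complex.Im z| <= cnorm z.
Proof.
by case: z => a b; rewrite /cnorm /= -sqrtr_sqr ler_wsqrtr// lerDr sqr_ge0.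
Qed.

Lemma cnorm_ReIm (z : C) : cnorm z <= `|complex.Re z| + `|complex.Im z|.
Proof.
case: z => a b; rewrite /cnorm /= -[leRHS]ger0_norm ?addr_ge0// -sqrtr_sqr.
rewrite ler_wsqrtr//.
rewrite sqrrD !real_normK ?num_real// -addrA lerD2l lerDr.
by rewrite mulrn_wge0// mulr_ge0.
Qed.

Lemma cnorm_sum (I : Type) (r : seq I) (P : pred I) (F : I -> C) :
  cnorm (\sum_(i <- r | P i) F i) <= \sum_(i <- r | P i) cnorm (F i).
Proof.
elim/big_rec2: _ => [|i y x _ H]; first by rewrite cnorm0.
by rewrite (le_trans (cnormD _ _))// lerD2l.
Qed.

(** The sum of the moduli of the entries.  Contrary to their maximum, it is
    submultiplicative. *)
Definition l1norm m n (A : 'M[C]_(m, n)) : R := \sum_i \sum_j cnorm (A i j).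

Section basic.
Variables m n : nat.
Implicit Types A B : 'M[C]_(m, n).

Lemma l1norm_ge0 A : 0 <= l1norm A.
Proof. by do 2![apply: sumr_ge0 => ? _]; exact: cnorm_ge0. Qed.

Lemma l1normD A B : l1norm (A + B) <= l1norm A + l1norm B.
Proof.
rewrite -big_split ler_sum//= => i _; rewrite -big_split ler_sum//= => j _.
by rewrite mxE cnormD.
Qed.

Lemma l1normN A : l1norm (- A) = l1norm A.
Proof. by do 2![apply: eq_bigr => ? _]; rewrite mxE cnormN. Qed.

Lemma l1normB A B : l1norm (A - B) <= l1norm A + l1norm B.
Proof. by rewrite -(l1normN B) l1normD. Qed.

Lemma l1norm_dist A B : l1norm (A - B) = l1norm (B - A).
Proof. by rewrite -l1normN opprB. Qed.

Lemma l1normZ a A : l1norm (a *: A) = cnorm a * l1norm A.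
Proof.
rewrite mulr_sumr; apply: eq_bigr => i _; rewrite mulr_sumr.
by apply: eq_bigr => j _; rewrite mxE cnormM.
Qed.

Lemma l1norm0 : l1norm (0 : 'M[C]_(m, n)) = 0.
Proof.
by rewrite /l1norm big1// => i _; rewrite big1// => j _; rewrite mxE cnorm0.
Qed.

Lemma cnorm_le_l1norm A i j : cnorm (A i j) <= l1norm A.
Proof.
rewrite /l1norm (bigD1 i)//= (bigD1 j)//= -addrA lerDl addr_ge0//.
  by apply: sumr_ge0 => k _; exact: cnorm_ge0.
by apply: sumr_ge0 => k _; apply: sumr_ge0 => l _; exact: cnorm_ge0.
Qed.

Lemma l1norm0_eq0 A : l1norm A = 0 -> A = 0.
Proof.
move=> A0; apply/matrixP => i j; rewrite mxE; apply: cnorm0_eq0.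
by apply/eqP; rewrite eq_le cnorm_ge0 andbT -A0 cnorm_le_l1norm.
Qed.

Lemma l1norm_sum (I : Type) (r : seq I) (P : pred I) (F : I -> 'M[C]_(m, n)) :
  l1norm (\sum_(i <- r | P i) F i) <= \sum_(i <- r | P i) l1norm (F i).
Proof.
elim/big_rec2: _ => [|i y x _ H]; first by rewrite l1norm0.
by rewrite (le_trans (l1normD _ _))// lerD2l.
Qed.

End basic.

Lemma l1normM m n p (A : 'M[C]_(m, n)) (B : 'M[C]_(n, p)) :
  l1norm (A *m B) <= l1norm A * l1norm B.
Proof.
apply: (@le_trans _ _ (\sum_i \sum_k \sum_j cnorm (A i j) * cnorm (B j k))).
  apply: ler_sum => i _; apply: ler_sum => k _; rewrite mxE.
  by rewrite (le_trans (cnorm_sum _ _ _))// ler_sum// => j _; rewrite cnormM.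
rewrite /l1norm mulr_suml; apply: ler_sum => i _.
rewrite exchange_big mulr_suml; apply: ler_sum => j _ /=.
rewrite -mulr_sumr ler_wpM2l ?cnorm_ge0//.
rewrite [leRHS](bigD1 j)//= lerDl.
by apply: sumr_ge0 => k _; apply: sumr_ge0 => l _; exact: cnorm_ge0.
Qed.

(** The factor [n.+1] is the norm of the identity matrix, for [k = 0]. *)
Lemma l1normX n (A : 'M[C]_n.+1) k : l1norm (A ^+ k) <= n.+1%:R * l1norm A ^+ k.
Proof.
elim: k => [|k IH].
  rewrite !expr0 mulr1 /l1norm (eq_bigr (fun=> 1)) ?sumr_const ?card_ord// => i _.
  rewrite (bigD1 i)//= mxE eqxx cnorm1 big1 ?addr0// => j /negbTE ji.
  by rewrite mxE eq_sym ji cnorm0.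
by rewrite exprS (le_trans (l1normM _ _))// exprS mulrCA ler_wpM2l// l1norm_ge0.
Qed.

Lemma cvg_sumr (K : numFieldType) (V : normedModType K) (T I : Type)
    (F : set_system T) {FF : Filter F} (r : seq I) (f : I -> T -> V) (l : I -> V) :
  (forall i, f i t @[t --> F] --> l i) ->
  \sum_(i <- r) f i t @[t --> F] --> \sum_(i <- r) l i.
Proof.
move=> fl; elim: r => [|i r IH].
  by rewrite big_nil; under eq_fun do rewrite big_nil; exact: cvg_cst.
rewrite big_cons; under eq_fun do rewrite big_cons.
exact: cvgD.
Qed.

Lemma cvg_cnormP (T : Type) (F : set_system T) {FF : Filter F} (f : T -> C) (l : C) :
  f @ F --> l <-> cnorm (f t - l) @[t --> F] --> (0 : R).
Proof.
split=> [/cvgrPdist_lt H|/cvgrPdist_lt H].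
  apply/cvgrPdist_lt => e e0.
  have e0' : (0 : C) < (e%:C)%C by rewrite ltcR.
  have := H _ e0'; apply: filterS => t; rewrite cnormE ltcR.
  by rewrite sub0r normrN ger0_norm ?cnorm_ge0// -cnormN opprB.
apply/cvgrPdist_lt => e; case: e => e e' e0.
have [e'0 {}e0] : e' = 0 /\ 0 < e.
  by move: e0; rewrite ltcE /= => /andP[/eqP -> ->].
have := H _ e0; apply: filterS => t; rewrite cnormE e'0 ltcR.
by rewrite sub0r normrN ger0_norm ?cnorm_ge0// -cnormN opprB.
Qed.

(** The topology of matrices, given by the maximum of the moduli of the
    entries, is also that of [l1norm]. *)
Lemma cvg_l1normP m n (T : Type) (F : set_system T) {FF : Filter F}
    (f : T -> 'M[C]_(m, n)) (l : 'M[C]_(m, n)) :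
  f @ F --> l <-> l1norm (f t - l) @[t --> F] --> (0 : R).
Proof.
split=> [fl|H].
  rewrite [X in _ --> X](_ : _ = \sum_(i < m) \sum_(j < n) (0 : R)); last first.
    by rewrite big1// => i _; rewrite big1.
  apply: cvg_sumr => i; apply: cvg_sumr => j.
  have /cvg_cnormP : f t i j @[t --> F] --> l i j.
      apply: (cvg_comp f (fun M : 'M[C]_(m, n) => M i j) fl).
    exact: coord_continuous.
  rewrite (_ : (fun t => _) = fun t => cnorm ((f t - l) i j)) //.
  by apply/funext => t; rewrite !mxE.
apply/cvg_ballP => e e0.
have e0' : 0 < complex.Re e by move: e0; rewrite ltcE /= => /andP[].
move/cvgrPdist_lt: H => /(_ _ e0'); apply: filterS => t.
rewrite sub0r normrN ger0_norm ?l1norm_ge0// => Hlt; split=> // i j.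
rewrite -ball_normE /= cnormE ltcE /=; move: e0; rewrite ltcE /= => /andP[-> _].
apply: le_lt_trans Hlt.
have := cnorm_le_l1norm (f t - l) i j; rewrite !mxE.
by rewrite -cnormN opprB.
Qed.

End norm.

(** * Completeness and convergence of the exponential series *)

Section completeness.
Variable R : realType.
Local Notation C := (Cplx R).

Lemma cvg0_le (T : Type) (F : set_system T) {FF : Filter F} (f g : T -> R) :
  (\forall t \near F, 0 <= f t <= g t) -> g @ F --> (0 : R) -> f @ F --> (0 : R).
Proof. by move=> fg g0; exact: (squeeze_cvgr fg (cvg_cst (0 : R)) g0). Qed.

Lemma cvg_mx_entry m n (T : Type) (F : set_system T) {FF : Filter F}
    (f : T -> 'M[C]_(m, n)) (l : 'M[C]_(m, n)) :
  (forall i j, f t i j @[t --> F] --> l i j) -> f @ F --> l.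
Proof.
move=> fl; apply/cvg_l1normP.
rewrite [X in _ --> X](_ : _ = \sum_(i < m) \sum_(j < n) (0 : R)); last first.
  by rewrite big1// => i _; rewrite big1.
apply: cvg_sumr => i; apply: cvg_sumr => j.
have /cvg_cnormP := fl i j.
rewrite (_ : (fun t => _) = fun t => cnorm ((f t - l) i j)) //.
by apply/funext => t; rewrite !mxE.
Qed.

Lemma cvg_bounded_variation (x u : R ^nat) :
  (forall k, `|x k.+1 - x k| <= u k) -> cvgn (series u) -> cvgn x.
Proof.
move=> xu cu.
have : cvgn (series (telescope x)).
  apply: normed_cvg; apply: series_le_cvg cu => [k|k|k].
  - exact: normr_ge0.
  - exact: le_trans (xu k).
  - exact: xu.
rewrite telescopeK => /(is_cvgD (is_cvg_cst (x 0%N))).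
rewrite (_ : _ + _ = x)//.
by apply/funext => k; rewrite fctE /= addrC subrK.
Qed.

(** Completeness of the space of complex matrices, for the sequences whose
    increments have summable norms. *)
Lemma cvg_mx_bounded_variation m n (A : nat -> 'M[C]_(m, n)) (u : R ^nat) :
  (forall k, l1norm (A k.+1 - A k) <= u k) -> cvgn (series u) ->
  exists L : 'M[C]_(m, n), A k @[k --> \oo] --> L.
Proof.
move=> Au cu.
have cRe i j : cvgn (fun k => complex.Re (A k i j)).
  apply: cvg_bounded_variation cu => k; apply: le_trans (Au k).
  apply: le_trans (cnorm_le_l1norm _ i j); rewrite !mxE -raddfB.
  exact: (cnorm_Re (A k.+1 i j - A k i j)).
have cIm i j : cvgn (fun k => complex.Im (A k i j)).
  apply: cvg_bounded_variation cu => k; apply: le_trans (Au k).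
  apply: le_trans (cnorm_le_l1norm _ i j); rewrite !mxE -raddfB.
  exact: (cnorm_Im (A k.+1 i j - A k i j)).
exists (\matrix_(i, j) (limn (fun k => complex.Re (A k i j)) +i*
                        limn (fun k => complex.Im (A k i j)))%C).
apply: cvg_mx_entry => i j; rewrite mxE; apply/cvg_cnormP.
have H (x : R ^nat) : cvgn x -> `|x k - limn x| @[k --> \oo] --> (0 : R).
  by move=> cx; apply/norm_cvg0P/subr_cvg0.
have H2 := @cvgD _ _ _ _ eventually_filter _ _ _ _ (H _ (cRe i j)) (H _ (cIm i j)).
rewrite addr0 in H2; apply: cvg0_le H2; apply: nearW => k; rewrite cnorm_ge0 /=.
by rewrite fctE (le_trans (cnorm_ReIm _))//=; case: (A k i j).
Qed.

End completeness.

Section expm.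
Variables (R : realType) (n : nat).
Local Notation C := (Cplx R).
Implicit Types A B : 'M[C]_n.+1.

(** The general term of the exponential series. *)
Definition expm_term A k : 'M[C]_n.+1 := (k`!%:R : C)^-1 *: A ^+ k.

Lemma cnorm_Vfact k : cnorm ((k`!%:R : C)^-1) = (k`!%:R : R)^-1.
Proof. by rewrite cnormV cnorm_nat. Qed.

Lemma cvg_expm A : series (expm_term A) k @[k --> \oo] --> expm A.
Proof.
have [] := @cvg_mx_bounded_variation R _ _ (series (expm_term A))
    (fun k => n.+1%:R * exp_coeff (l1norm A) k).
- move=> k; rewrite seriesSB l1normZ cnorm_Vfact mulrC /exp_coeff /= mulrA.
  by rewrite ler_wpM2r ?invr_ge0// l1normX.
- have := @is_cvg_series_exp_coeff R (l1norm A).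
  by move=> H; exact: (is_cvg_seriesZ (k := n.+1%:R) H).
- by move=> L AL; rewrite /expm (cvg_lim _ AL)//; exact: norm_hausdorff.
Qed.

End expm.
Arguments cvg_expm {R n} A.

(** * Limits of matrix products and bounds *)

Section limits.
Variable R : realType.
Local Notation C := (Cplx R).

Lemma cvg_mulmxl m n p (T : Type) (F : set_system T) {FF : Filter F}
    (f : T -> 'M[C]_(n, p)) (l : 'M[C]_(n, p)) (Q : 'M[C]_(m, n)) :
  f @ F --> l -> Q *m f t @[t --> F] --> Q *m l.
Proof.
move=> /cvg_l1normP fl; apply/cvg_l1normP.
have H : l1norm Q * l1norm (f t - l) @[t --> F] --> (0 : R).
  by rewrite -(mulr0 (l1norm Q)); apply: cvgM => //; exact: cvg_cst.
apply: cvg0_le H; apply: nearW => t.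
by rewrite l1norm_ge0 -mulmxBr l1normM.
Qed.

Lemma cvg_mulmxr m n p (T : Type) (F : set_system T) {FF : Filter F}
    (f : T -> 'M[C]_(m, n)) (l : 'M[C]_(m, n)) (Q : 'M[C]_(n, p)) :
  f @ F --> l -> f t *m Q @[t --> F] --> l *m Q.
Proof.
move=> /cvg_l1normP fl; apply/cvg_l1normP.
have H : l1norm (f t - l) * l1norm Q @[t --> F] --> (0 : R).
  by rewrite -(mul0r (l1norm Q)); apply: cvgM => //; exact: cvg_cst.
apply: cvg0_le H; apply: nearW => t.
by rewrite l1norm_ge0 -mulmxBl l1normM.
Qed.

Lemma cvg_mx_unique m n (T : Type) (F : set_system T) {FF : ProperFilter F}
    (f : T -> 'M[C]_(m, n)) (k l : 'M[C]_(m, n)) :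
  f @ F --> k -> f @ F --> l -> k = l.
Proof. exact: (cvg_unique (@norm_hausdorff _ _)). Qed.

Lemma l1norm_lim_le m n (T : Type) (F : set_system T) {FF : ProperFilter F}
    (f : T -> 'M[C]_(m, n)) (l : 'M[C]_(m, n)) (c : R) :
  (forall t, l1norm (f t) <= c) -> f @ F --> l -> l1norm l <= c.
Proof.
move=> fc /cvg_l1normP fl.
have H : c + l1norm (f t - l) @[t --> F] --> c.
  by rewrite -[X in _ --> X]addr0; apply: cvgD => //; exact: cvg_cst.
apply: (cvgr_to_ge H); apply: nearW => t.
by rewrite -{1}(subKr (f t) l) (le_trans (l1normB _ _))// lerD.
Qed.

End limits.
Arguments cvg_mulmxl {R m n p T F FF f l} Q _.
Arguments cvg_mulmxr {R m n p T F FF f l} Q _.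

(** * Solving exp B = 1 + E for small E *)

Section remainder.
Variables (R : realType) (n : nat).
Local Notation C := (Cplx R).
Implicit Types A B Q : 'M[C]_n.+1.

(** For positive exponents the factor [n.+1] of [l1normX] is superfluous. *)
Lemma l1normXS A k : l1norm (A ^+ k.+1) <= l1norm A ^+ k.+1.
Proof.
elim: k => [|k IH]; first by rewrite !expr1.
by rewrite exprS (le_trans (l1normM _ _))// [leRHS]exprS ler_wpM2l// l1norm_ge0.
Qed.

Lemma l1normX_lipschitz (r : R) A B k : l1norm A <= r -> l1norm B <= r ->
  l1norm (A ^+ k.+1 - B ^+ k.+1) <= k.+1%:R * r ^+ k * l1norm (A - B).
Proof.
move=> Ar Br; have r0 : 0 <= r := le_trans (l1norm_ge0 A) Ar.
elim: k => [|k IH]; first by rewrite !expr1 expr0 !mul1r.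
have -> : A ^+ k.+2 - B ^+ k.+2 =
    A *m (A ^+ k.+1 - B ^+ k.+1) + (A - B) *m B ^+ k.+1.
  by rewrite [A ^+ k.+2]exprS [B ^+ k.+2]exprS mulmxBr mulmxBl addrA subrK.
apply: (le_trans (l1normD _ _)).
have H1 : l1norm (A *m (A ^+ k.+1 - B ^+ k.+1)) <=
    r * (k.+1%:R * r ^+ k * l1norm (A - B)).
  by rewrite (le_trans (l1normM _ _))// ler_pM ?l1norm_ge0.
have H2 : l1norm ((A - B) *m B ^+ k.+1) <= l1norm (A - B) * r ^+ k.+1.
  rewrite (le_trans (l1normM _ _))// ler_wpM2l ?l1norm_ge0//.
  rewrite (le_trans (l1normXS _ _))//.
  by rewrite lerXn2r ?nnegrE ?l1norm_ge0.
apply: (le_trans (lerD H1 H2)).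
by rewrite le_eqVlt; apply/orP; left; apply/eqP; rewrite [k.+2%:R]mulrSr exprS; ring.
Qed.

(** The remainder of order 2 of the exponential series. *)
Definition expm_rem A : 'M[C]_n.+1 := expm A - 1 - A.

Lemma cvg_expm_rem A :
  \sum_(0 <= j < k) expm_term A j.+2 @[k --> \oo] --> expm_rem A.
Proof.
have H : series (expm_term A) (k + 2)%N @[k --> \oo] --> expm A.
  by have := cvg_expm A; rewrite -(cvg_shiftn 2).
have {}H : series (expm_term A) (k + 2)%N - 1 @[k --> \oo] --> expm A - 1.
  exact: (cvgB H (cvg_cst (1 : 'M[C]_n.+1))).
have {H} : series (expm_term A) (k + 2)%N - 1 - A @[k --> \oo] --> expm_rem A.
  rewrite /expm_rem; exact: (cvgB H (cvg_cst A)).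
rewrite (_ : (fun k => _) = (fun k => \sum_(0 <= j < k) expm_term A j.+2))//.
apply/funext => k.
rewrite /series /= addn2 !big_nat_recl//= /expm_term !fact0 !invr1 !scale1r.
by rewrite expr0 expr1 [1 + _]addrC addrK [A + _]addrC addrK.
Qed.

Lemma geometric_le (r : R) k : 0 <= r -> r <= 1 / 2 ->
  \sum_(0 <= j < k) r ^+ j.+1 <= 2 * r.
Proof.
move=> r0 r12; elim: k => [|k IH]; first by rewrite big_nil mulr_ge0.
rewrite big_nat_recl//= expr1.
under eq_bigr do rewrite exprS.
rewrite -mulr_sumr mulrDl mul1r lerD2l ler_piMr//.
by apply: (le_trans IH); lra.
Qed.

(** By [l1normX_lipschitz], the term of degree [j + 2] of the remainder has the
    Lipschitz constant [r ^ (j + 1) / (j + 1)!] on the ball of radius [r], and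
    the sum of these is at most [2 * r]. *)
Lemma expm_rem_lipschitz (r : R) A B :
  r <= 1 / 2 -> l1norm A <= r -> l1norm B <= r ->
  l1norm (expm_rem A - expm_rem B) <= 2 * r * l1norm (A - B).
Proof.
move=> r12 Ar Br; have r0 : 0 <= r := le_trans (l1norm_ge0 A) Ar.
have H : \sum_(0 <= j < k) expm_term A j.+2 - \sum_(0 <= j < k) expm_term B j.+2
    @[k --> \oo] --> expm_rem A - expm_rem B.
  exact: (cvgB (@cvg_expm_rem A) (@cvg_expm_rem B)).
apply: (l1norm_lim_le _ H) => k.
rewrite -sumrB (le_trans (l1norm_sum _ _ _))//.
apply: (@le_trans _ _ (\sum_(0 <= j < k) r ^+ j.+1 * l1norm (A - B))); last first.
  by rewrite -mulr_suml ler_wpM2r ?l1norm_ge0// geometric_le.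
apply: ler_sum => j _; rewrite /expm_term -scalerBr l1normZ cnorm_Vfact.
rewrite ler_pdivrMl ?ltr0n ?fact_gt0//.
apply: (le_trans (l1normX_lipschitz _ Ar Br)).
rewrite mulrA ler_wpM2r ?l1norm_ge0// ler_wpM2r ?exprn_ge0//.
by rewrite ler_nat factS leq_pmulr// fact_gt0.
Qed.

End remainder.
Arguments cvg_expm_rem {R n} A.

Section existence.
Variables (R : realType) (n : nat).
Local Notation C := (Cplx R).
Implicit Types A B E Q : 'M[C]_n.+1.

Lemma expm_rem0 : expm_rem (0 : 'M[C]_n.+1) = 0.
Proof.
apply: (cvg_mx_unique (cvg_expm_rem (0 : 'M[C]_n.+1))).
rewrite (_ : (fun k => _) = cst 0); first exact: cvg_cst.
apply/funext => k; rewrite big1// => j _.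
by rewrite /expm_term expr0n scaler0.
Qed.

Lemma l1norm_expm_rem (r : R) A : r <= 1 / 2 -> l1norm A <= r ->
  l1norm (expm_rem A) <= 2 * r * l1norm A.
Proof.
move=> r12 Ar; have r0 : l1norm (0 : 'M[C]_n.+1) <= r.
  by rewrite l1norm0 (le_trans (l1norm_ge0 A)).
by have := expm_rem_lipschitz r12 Ar r0; rewrite expm_rem0 !subr0.
Qed.

Lemma comm_expm Q A : Q *m A = A *m Q -> Q *m expm A = expm A *m Q.
Proof.
move=> QA; have H : Q *m series (expm_term A) t @[t --> \oo] --> Q *m expm A.
  exact: (cvg_mulmxl Q (cvg_expm A)).
have : series (expm_term A) t *m Q @[t --> \oo] --> expm A *m Q.
  exact: (cvg_mulmxr Q (cvg_expm A)).
rewrite (_ : (fun t => _ *m Q) = (fun t => Q *m series (expm_term A) t)).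
  by move=> /(cvg_mx_unique H).
apply/funext => k; rewrite mulmx_suml mulmx_sumr; apply: eq_bigr => j _.
rewrite /expm_term -scalemxAl -scalemxAr; congr (_ *: _).
exact/esym/(@commrX _ Q A j QA).
Qed.

Lemma comm_expm_rem Q A : Q *m A = A *m Q -> Q *m expm_rem A = expm_rem A *m Q.
Proof.
move=> QA; rewrite /expm_rem !mulmxBl !mulmxBr (comm_expm QA) QA.
by rewrite mulmx1 mul1mx.
Qed.

(** The iteration of [X |-> E - (exp X - 1 - X)] from [0]; its fixed points are
    the solutions of [exp X = 1 + E]. *)
Fixpoint log_iter E k : 'M[C]_n.+1 :=
  if k is k'.+1 then E - expm_rem (log_iter E k') else 0.

(** The iterates stay in the ball of radius [2 * l1norm E <= 1 / 4], on which the
    remainder is Lipschitz of constant [1 / 2]. *)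
Lemma l1norm_log_iter E k :
  l1norm E <= 1 / 8 -> l1norm (log_iter E k) <= 2 * l1norm E.
Proof.
move=> E8; elim: k => [|k IH] /=; first by rewrite l1norm0 mulr_ge0// l1norm_ge0.
have H : l1norm (log_iter E k) <= 1 / 4 by apply: (le_trans IH); lra.
have H2 := @l1norm_expm_rem (1 / 4) (log_iter E k) ltac:(lra) H.
by apply: (le_trans (l1normB _ _)); lra.
Qed.

Lemma log_iter_step E k : l1norm E <= 1 / 8 ->
  l1norm (log_iter E k.+1 - log_iter E k) <= l1norm E * (1 / 2) ^+ k.
Proof.
move=> E8; elim: k => [|k IH].
  by rewrite /= expm_rem0 !subr0 expr0 mulr1.
have H j : l1norm (log_iter E j) <= 1 / 4.
  by apply: (le_trans (l1norm_log_iter j E8)); lra.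
have -> : log_iter E k.+2 - log_iter E k.+1 =
    expm_rem (log_iter E k) - expm_rem (log_iter E k.+1).
  by rewrite [LHS]/= addrC opprB addrA subrK.
have := @expm_rem_lipschitz _ _ (1 / 4) _ _ ltac:(lra) (H k) (H k.+1).
move=> /le_trans; apply; rewrite l1norm_dist exprS.
set x := l1norm (_ - _) in IH *; set y := _ ^+ k in IH *; lra.
Qed.

(** Near the identity the exponential has a right inverse, equal to
    [B = E + O(|E|^2)] at [1 + E].  The last property holds because the iterates
    are obtained from [E] by operations which preserve commutation; it allows
    the comparison of [B] with any other logarithm of [1 + E]. *)
Lemma expm_near1 E : l1norm E <= 1 / 8 ->
  exists B, [/\ expm B = 1 + E, l1norm B <= 2 * l1norm E,
                l1norm (B - E) <= 8 * l1norm E ^+ 2 &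
                forall Q, Q *m E = E *m Q -> Q *m B = B *m Q].
Proof.
move=> E8.
have [B cB] : exists B, log_iter E k @[k --> \oo] --> B.
  apply: (cvg_mx_bounded_variation (fun k => log_iter_step k E8)).
  apply: (@is_cvg_geometric_series _ (l1norm E) (1 / 2)).
  by rewrite ger0_norm; lra.
have B2 : l1norm B <= 2 * l1norm E.
  exact: (l1norm_lim_le (fun k => l1norm_log_iter k E8) cB).
have B4 : l1norm B <= 1 / 4 by rewrite (le_trans B2)//; lra.
have BE : B = E - expm_rem B.
  have cB1 : log_iter E k.+1 @[k --> \oo] --> B.
    have := cB; rewrite -(cvg_shiftn 1).
    by under eq_fun do rewrite addn1.
  apply: (cvg_mx_unique cB1); rewrite /=.
  apply: cvgB; first exact: cvg_cst.
  apply/cvg_l1normP; have /cvg_l1normP := cB; apply: cvg0_le; apply: nearW => k.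
  rewrite l1norm_ge0 /=.
  have H : l1norm (log_iter E k) <= 1 / 4.
    by apply: (le_trans (l1norm_log_iter k E8)); lra.
  have := @expm_rem_lipschitz _ _ (1 / 4) _ _ ltac:(lra) H B4.
  have := l1norm_ge0 (log_iter E k - B); set x := l1norm (_ - _); lra.
exists B; split => //.
- have : E = B + expm_rem B by rewrite [X in X + _]BE subrK.
  by move=> ->; rewrite /expm_rem [B + _]addrC subrK addrC subrK.
- have -> : B - E = - expm_rem B by rewrite {1}BE addrC addKr.
  rewrite l1normN; have := @l1norm_expm_rem (2 * l1norm E) B ltac:(lra) B2.
  move=> /le_trans; apply.
  rewrite (_ : 8 * _ = 2 * (2 * l1norm E) * (2 * l1norm E)); last by ring.
  by rewrite ler_wpM2l// !mulr_ge0// l1norm_ge0.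
- move=> Q QE; have H : Q *m log_iter E t @[t --> \oo] --> Q *m B.
    exact: (cvg_mulmxl Q cB).
  have : log_iter E t *m Q @[t --> \oo] --> B *m Q by exact: (cvg_mulmxr Q cB).
  rewrite (_ : (fun t => _ *m Q) = (fun t => Q *m log_iter E t)).
    by move=> /(cvg_mx_unique H).
  apply/funext; elim=> [|k IH] /=; first by rewrite mul0mx mulmx0.
  by rewrite mulmxBl mulmxBr QE comm_expm_rem.
Qed.

End existence.

(** * The complex exponential *)

Section exp_sum.
Variable F : numFieldType.

(** The partial sums of the exponential series, in the real or the complex
    field. *)
Definition exp_sum (K : nat) (z : F) : F := \sum_(0 <= k < K) z ^+ k / k`!%:R.

Lemma big_triangle (f : nat -> nat -> F) K :
  \sum_(0 <= k < K) \sum_(0 <= i < k.+1) f (k - i)%N i =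
  \sum_(0 <= i < K) \sum_(0 <= j < K - i) f j i.
Proof.
elim: K => [|K IH]; first by rewrite !big_nil.
rewrite big_nat_recr//= IH [RHS]big_nat_recr//= subSnn big_nat1.
rewrite [in LHS](big_nat_recr K)//= subnn addrA; congr (_ + _).
rewrite -big_split /= !big_nat; apply: eq_bigr => i /andP[_ iK].
by rewrite subSn 1?ltnW// big_nat_recr.
Qed.

(** The product of two partial sums exceeds the partial sum at [z + w] by the
    monomials of total degree at least [K]. *)
Lemma exp_sumD K (z w : F) :
  exp_sum K z * exp_sum K w - exp_sum K (z + w) =
  \sum_(0 <= i < K) \sum_(K - i <= j < K) (z ^+ j / j`!%:R) * (w ^+ i / i`!%:R).
Proof.
have -> : exp_sum K (z + w) =
    \sum_(0 <= i < K) \sum_(0 <= j < K - i) (z ^+ j / j`!%:R) * (w ^+ i / i`!%:R).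
  rewrite -(big_triangle (fun j i => (z ^+ j / j`!%:R) * (w ^+ i / i`!%:R))).
  apply: eq_bigr => k _; rewrite exprDn mulr_suml big_mkord.
  apply: eq_bigr => -[i /=]; rewrite ltnS => ik _.
  rewrite -mulr_natr -(bin_fact ik).
  have : (k - i)`!%:R != 0 :> F by rewrite pnatr_eq0 -lt0n fact_gt0.
  have : i`!%:R != 0 :> F by rewrite pnatr_eq0 -lt0n fact_gt0.
  have : 'C(k, i)%:R != 0 :> F by rewrite pnatr_eq0 -lt0n bin_gt0.
  by rewrite !natrM => h1 h2 h3; field; rewrite h1 h2 h3.
rewrite /exp_sum big_distrlr exchange_big /= -sumrB.
apply: eq_bigr => i _.
by apply/eqP; rewrite subr_eq addrC -big_cat_nat ?leq_subr.
Qed.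

End exp_sum.

Section cexp.
Variable R : realType.
Local Notation C := (Cplx R).

(** These monomials have nonnegative coefficients: the error for complex
    arguments is bounded by the error for their moduli, which tends to [0] by the
    addition formula of the real exponential. *)
Lemma cnorm_exp_sumD K (z w : C) :
  cnorm (exp_sum K z * exp_sum K w - exp_sum K (z + w)) <=
  exp_sum K (cnorm z) * exp_sum K (cnorm w) - exp_sum K (cnorm z + cnorm w).
Proof.
rewrite !exp_sumD (le_trans (cnorm_sum _ _ _))// ler_sum// => i _.
rewrite (le_trans (cnorm_sum _ _ _))// ler_sum// => j _.
by rewrite !cnormM !cnormV !cnormX !cnorm_nat.
Qed.

Lemma cvg_exp_sum (x : R) : exp_sum K x @[K --> \oo] --> expR x.
Proof. exact: is_cvg_series_exp_coeff. Qed.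

Lemma exp_sum_real K (x : R) : exp_sum K (x%:C%C : C) = (exp_sum K x)%:C%C.
Proof.
rewrite /exp_sum rmorph_sum; apply: eq_bigr => k _.
by rewrite rmorphM rmorphXn fmorphV rmorph_nat.
Qed.

Lemma cvg_exp_sum_mul (z w : C) :
  cnorm (exp_sum K z * exp_sum K w - exp_sum K (z + w)) @[K --> \oo] --> (0 : R).
Proof.
have H : exp_sum K (cnorm z) * exp_sum K (cnorm w) -
    exp_sum K (cnorm z + cnorm w) @[K --> \oo] --> (0 : R).
  rewrite -[X in _ --> X](subrr (expR (cnorm z) * expR (cnorm w))) -{2}expRD.
  by apply: cvgB; [apply: cvgM|]; exact: cvg_exp_sum.
apply: cvg0_le H; apply: nearW => K.
by rewrite cnorm_ge0 cnorm_exp_sumD.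
Qed.

Lemma imag_even_power (y : R) k :
  (((0 +i* y)%C : C) ^+ k.*2) = (((-1) ^+ k * y ^+ k.*2)%:C)%C.
Proof.
rewrite -mul2n !exprM (_ : (0 +i* y)%C ^+ 2 = ((- (y ^+ 2))%:C)%C); last first.
  by rewrite expr2; simpc; rewrite -expr2.
by rewrite -rmorphXn /= [in LHS]exprNn.
Qed.

Lemma exp_term_imag (y : R) k :
  (((0 +i* y)%C : C) ^+ k / k`!%:R) = (cos_coeff y k +i* sin_coeff y k)%C.
Proof.
have -> : (k`!%:R : C)^-1 = (((k`!%:R : R)^-1)%:C)%C by rewrite fmorphV rmorph_nat.
rewrite cos_coeffE sin_coeffE /=; set r := _^-1.
rewrite -[X in _ ^+ X * _]odd_double_half.
have -> : y ^+ k = y ^+ odd k * y ^+ k./2.*2 by rewrite -exprD odd_double_half.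
have -> : (odd k)%:R * (-1) ^+ k.-1./2 = (odd k)%:R * (-1) ^+ k./2 :> R.
  case: k {r} => [|k] /=; first by rewrite mul0r.
  by case: (boolP (odd k)) => ok; rewrite /= ?mul0r// uphalf_half (negbTE ok).
rewrite exprD imag_even_power.
case: (odd k) => /=; simpc; rewrite ?expr0 ?expr1; simpc; congr (_ +i* _)%C; ring.
Qed.

Lemma exp_sum_imag K (y : R) : exp_sum K ((0 +i* y)%C : C) =
  (series (cos_coeff y) K +i* series (sin_coeff y) K)%C.
Proof.
elim: K => [|K IH]; first by rewrite /exp_sum /series /= !big_nil.
rewrite /exp_sum big_nat_recr//= -/(exp_sum K _) IH exp_term_imag.
by rewrite !seriesS; simpc; rewrite ![series _ _ + _]addrC.
Qed.

(** The complex exponential, in terms of the real functions [expR], [cos] and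
    [sin]; [cvg_cexp] identifies it with the sum of the exponential series. *)
Definition cexp (z : C) : C :=
  ((expR (complex.Re z))%:C * (cos (complex.Im z) +i* sin (complex.Im z)))%C.

Lemma cvg_cexp (z : C) : exp_sum K z @[K --> \oo] --> cexp z.
Proof.
case: z => x y; rewrite /cexp /=.
have Hx : exp_sum K ((x%:C)%C : C) @[K --> \oo] --> ((expR x)%:C%C : C).
  apply/cvg_cnormP.
  have H : `|exp_sum K x - expR x| @[K --> \oo] --> (0 : R).
    by apply/norm_cvg0P/subr_cvg0; exact: cvg_exp_sum.
  apply: cvg0_le H; apply: nearW => K.
  by rewrite cnorm_ge0 exp_sum_real -rmorphB cnormr lexx.
have Hy : exp_sum K ((0 +i* y)%C : C) @[K --> \oo] --> ((cos y +i* sin y)%C : C).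
  apply/cvg_cnormP.
  have Hc : `|series (cos_coeff y) k - cos y| @[k --> \oo] --> (0 : R).
    apply/norm_cvg0P/subr_cvg0; rewrite cos.unlock.
    exact: is_cvg_series_cos_coeff.
  have Hs : `|series (sin_coeff y) k - sin y| @[k --> \oo] --> (0 : R).
    apply/norm_cvg0P/subr_cvg0; rewrite sin.unlock.
    exact: is_cvg_series_sin_coeff.
  have H : `|series (cos_coeff y) k - cos y| + `|series (sin_coeff y) k - sin y|
      @[k --> \oo] --> (0 : R).
    by rewrite -[X in _ --> X]addr0; exact: cvgD.
  apply: cvg0_le H; apply: nearW => K.
  by rewrite cnorm_ge0 exp_sum_imag (le_trans (cnorm_ReIm _))//= lexx.
have Hxy : exp_sum K ((x%:C)%C : C) * exp_sum K ((0 +i* y)%C : C) -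
    exp_sum K ((x +i* y)%C : C) @[K --> \oo] --> (0 : C).
  have := @cvg_exp_sum_mul (x%:C)%C (0 +i* y)%C.
  have <- : (x +i* y)%C = (x%:C + (0 +i* y))%C by simpc.
  move=> H; apply/cvg_cnormP; apply: cvg0_le H; apply: nearW => K.
  by rewrite subr0 cnorm_ge0 lexx.
have H := cvgB (cvgM Hx Hy) Hxy; rewrite subr0 in H.
rewrite (_ : (fun K => _) = (fun K =>
  exp_sum K ((x%:C)%C : C) * exp_sum K ((0 +i* y)%C : C) -
  (exp_sum K ((x%:C)%C : C) * exp_sum K ((0 +i* y)%C : C) -
    exp_sum K ((x +i* y)%C : C)))); first exact: H.
by apply/funext => K; rewrite subKr.
Qed.

Lemma cexp_eq0 z : (cexp z == 0) = false.
Proof.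
case: z => x y; apply/negbTE/eqP; rewrite /cexp /=; simpc => -[/eqP hx /eqP hy].
move: hx hy; rewrite !mulf_eq0 !expR_eq0 /= => /eqP cx /eqP sx.
have := cos2Dsin2 y; rewrite cx sx expr0n /= addr0 => /eqP.
by rewrite eq_sym oner_eq0.
Qed.

(** Half-angle formula: [1 - cos t = 2 * sin (t / 2) ^ 2]. *)
Lemma cos_eq1 (t : R) : `|t| < 2 * pi -> cos t = 1 -> t = 0.
Proof.
wlog t0 : t / 0 <= t => [H|].
  case: (leP 0 t) => t0; first exact: H.
  move=> tpi ct; apply/eqP; rewrite -oppr_eq0; apply/eqP.
  by apply: H; rewrite ?normrN ?cosN// oppr_ge0 ltW.
rewrite ger0_norm// => tpi ct; apply/eqP; rewrite eq_le t0 andbT leNgt.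
apply/negP => t_gt0.
have sp : 0 < sin (t / 2) by apply: sin_gt0_pi; apply/andP; split; lra.
have : cos t = cos (t / 2) ^+ 2 - sin (t / 2) ^+ 2.
  by rewrite {1}(splitr t) cosD -!expr2.
rewrite ct cos2sin2 => H.
have : 0 < sin (t / 2) ^+ 2 by rewrite exprn_gt0.
by lra.
Qed.

(** The complex exponential is injective on every open horizontal strip of
    height [2 * pi]. *)
Lemma cexp_inj (z w : C) : `|complex.Im z - complex.Im w| < 2 * pi ->
  cexp z = cexp w -> z = w.
Proof.
case: z w => [x y] [a b]; rewrite /cexp /= => yb; simpc => -[h1 h2].
have hx : expR x = expR a.
  have : (expR x) ^+ 2 = (expR a) ^+ 2.
    rewrite -[LHS]mulr1 -[RHS]mulr1 -{1}(cos2Dsin2 y) -(cos2Dsin2 b).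
    by rewrite !mulrDr -!exprMn h1 h2.
  by move/eqP; rewrite eqrXn2 ?expR_ge0// => /eqP.
move/expR_inj : (hx) => xa; rewrite hx in h1 h2.
have ea : expR a != 0 by rewrite expR_eq0.
move/(mulfI ea) : h1 => h1; move/(mulfI ea) : h2 => h2.
suff : y - b = 0 by move/eqP; rewrite subr_eq0 xa => /eqP ->.
by apply: cos_eq1 => //; rewrite cosB h1 h2 -!expr2 cos2Dsin2.
Qed.

End cexp.
Arguments cvg_cexp {R} z.

(** * Uniqueness of the principal logarithm *)

Section uniqueness.
Variables (R : realType) (n : nat).
Local Notation C := (Cplx R).
Implicit Types A B : 'M[C]_n.+1.

Lemma eigen_expX (w : 'rV[C]_n.+1) B (l : C) k :
  w *m B = l *: w -> w *m B ^+ k = l ^+ k *: w.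
Proof.
move=> wB; elim: k => [|k IH]; first by rewrite !expr0 mulmx1 scale1r.
by rewrite exprSr mulmxA IH -scalemxAl wB scalerA -exprSr.
Qed.

Lemma cvg_scale_rV m (f : nat -> C) (l : C) (w : 'rV[C]_m) :
  f @ \oo --> l -> f k *: w @[k --> \oo] --> l *: w.
Proof.
move=> /cvg_cnormP fl; apply/cvg_l1normP.
have H : cnorm (f k - l) * l1norm w @[k --> \oo] --> (0 : R).
  by rewrite -(mul0r (l1norm w)); apply: cvgM => //; exact: cvg_cst.
apply: cvg0_le H; apply: nearW => k.
by rewrite l1norm_ge0 -scalerBl l1normZ lexx.
Qed.

Arguments cvg_scale_rV [m f l] w _.

Lemma eigen_expm (w : 'rV[C]_n.+1) B (l : C) :
  w *m B = l *: w -> w *m expm B = cexp l *: w.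
Proof.
move=> wB.
have H1 : w *m series (expm_term B) k @[k --> \oo] --> w *m expm B.
  exact: (cvg_mulmxl w (cvg_expm B)).
have H2 : exp_sum k l *: w @[k --> \oo] --> cexp l *: w.
  exact: (cvg_scale_rV w (cvg_cexp l)).
apply: (cvg_mx_unique H1); apply: cvg_trans H2.
rewrite (_ : (fun k => w *m _) = (fun k => exp_sum k l *: w))//.
apply/funext => k; rewrite mulmx_sumr scaler_suml; apply: eq_bigr => j _.
by rewrite /expm_term -scalemxAr (eigen_expX _ wB) scalerA mulrC.
Qed.

(** Each difference [A ^ k - B ^ k] factors through [A - B], so that [y] times
    it is [k * l ^ (k - 1)] times the common eigenvector [w = y (A - B)].  This
    makes [cexp l], the derivative of the exponential at [l], appear. *)
Lemma eigen_expm_sub (w y : 'rV[C]_n.+1) A B (l : C) :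
  comm_mx A B -> w = y *m (A - B) ->
  w *m A = l *: w -> w *m B = l *: w ->
  y *m (expm A - expm B) = cexp l *: w.
Proof.
move=> AB wy wA wB.
have H1 : y *m (series (expm_term A) (k + 1)%N - series (expm_term B) (k + 1)%N)
    @[k --> \oo] --> y *m (expm A - expm B).
  apply: cvg_mulmxl.
  have HA : series (expm_term A) (k + 1)%N @[k --> \oo] --> expm A.
    by have := cvg_expm A; rewrite -(cvg_shiftn 1).
  have HB : series (expm_term B) (k + 1)%N @[k --> \oo] --> expm B.
    by have := cvg_expm B; rewrite -(cvg_shiftn 1).
  exact: (cvgB HA HB).
have H2 : exp_sum k l *: w @[k --> \oo] --> cexp l *: w.
  exact: (cvg_scale_rV w (cvg_cexp l)).
apply: (cvg_mx_unique H1); apply: cvg_trans H2.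
(* The term of degree 0 of the difference vanishes: one more term on the left. *)
rewrite (_ : (fun k => y *m _) = (fun k => exp_sum k l *: w))//.
apply/funext => k; rewrite -sumrB addn1 big_nat_recl//= /expm_term !expr0 subrr.
rewrite add0r.
rewrite mulmx_sumr scaler_suml; apply: eq_bigr => j _.
rewrite -scalerBr -scalemxAr subrXX_comm//.
rewrite -mulmxE mulmxA -wy mulmx_sumr.
rewrite (eq_bigr (fun=> l ^+ j *: w)); last first.
  move=> i _; rewrite mulmxA (eigen_expX _ wA) -scalemxAl (eigen_expX _ wB).
  by rewrite scalerA -exprD /= subnK// -ltnS.
rewrite sumr_const card_ord -[(_ *: w) *+ _]scaler_nat !scalerA; congr (_ *: _).
have h1 : j.+1%:R != 0 :> C by rewrite pnatr_eq0.
have h2 : j`!%:R != 0 :> C by rewrite pnatr_eq0 -lt0n fact_gt0.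
rewrite factS natrM; move: (j.+1%:R : C) (j`!%:R : C) h1 h2 => a b a0 b0.
by field; rewrite a0 b0.
Qed.

(** Two commuting principal logarithms [B] and [B'] of a matrix are equal:
    otherwise they have a common eigenvector in the row space of [B - B'], on
    which they have the same eigenvalue as their spectra lie in a strip where
    the exponential is injective, and this contradicts [eigen_expm_sub]. *)
Lemma principal_log_unique A B B' :
  is_principal_log A B -> is_principal_log A B' -> comm_mx B B' -> B = B'.
Proof.
move=> [eB sB] [eB' sB'] BB'; apply/eqP; rewrite -subr_eq0; apply/negPn/negP => N0.
set N := B - B' in N0.
have sN (f : 'M[C]_n.+1) : comm_mx N f -> (N *m f <= N)%MS.
  by move=> ->; exact: submxMl.
have NB : (N *m B <= N)%MS.
  by apply: sN; rewrite /comm_mx mulmxBl mulmxBr BB'.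
have NB' : (N *m B' <= N)%MS.
  by apply: sN; rewrite /comm_mx mulmxBl mulmxBr BB'.
have r0 : (0 < \rank N)%N by rewrite lt0n mxrank_eq0.
have [|v v0 /andP[vB vB']] :=
  @common_eigenvector2 C _ (complex.restrict N B) (complex.restrict N B') r0.
  by rewrite -(restrictM NB NB') -(restrictM NB' NB) BB'.
have /sub_rVP[l vl] := vB; have /sub_rVP[l' vl'] := vB'.
pose w := v *m row_base N.
have w0 : w != 0 by rewrite mul_mx_rowfree_eq0 ?row_base_free.
have wB : w *m B = l *: w.
  by apply/eigenspaceP; rewrite -eigenspace_restrict//; apply/eigenspaceP.
have wB' : w *m B' = l' *: w.
  by apply/eigenspaceP; rewrite -eigenspace_restrict//; apply/eigenspaceP.
have ll' : l = l'.
  have eig (M : 'M[C]_n.+1) a : w *m M = a *: w -> eigenvalue M a.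
    by move=> wM; apply/eigenvalueP; exists w.
  apply: cexp_inj.
    have /andP[h1 h2] := sB _ (eig _ _ wB).
    have /andP[h3 h4] := sB' _ (eig _ _ wB').
    by rewrite ltr_norml; apply/andP; split; lra.
  have : (cexp l - cexp l') *: w = 0.
    by rewrite scalerBl -(eigen_expm wB) -(eigen_expm wB') eB eB' subrr.
  by move/eqP; rewrite scaler_eq0 (negbTE w0) orbF subr_eq0 => /eqP.
rewrite -ll' in wB'.
have /submxP[y wy] : (w <= N)%MS.
  by rewrite (submx_trans (submxMl _ _))// eq_row_base.
have := eigen_expm_sub BB' wy wB wB'; rewrite eB eB' subrr mulmx0 => /esym/eqP.
by rewrite scaler_eq0 (negbTE w0) orbF cexp_eq0.
Qed.

End uniqueness.

Section near1.
Variables (R : realType) (n : nat).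
Local Notation C := (Cplx R).

Lemma eigenvalue_le (B : 'M[C]_n.+1) l : eigenvalue B l -> cnorm l <= l1norm B.
Proof.
move=> /eigenvalueP[w wB w0].
have mw : 0 < l1norm w.
  rewrite lt_neqAle l1norm_ge0 andbT eq_sym; apply/eqP => /l1norm0_eq0/eqP.
  by rewrite (negbTE w0).
by rewrite -(ler_pM2r mw) -l1normZ -wB mulrC l1normM.
Qed.

(** The logarithm is defined near the identity, with [log (1 + E) = E + O(|E|^2)].
    Since [logm (1 + E)] is an arbitrary principal logarithm, the estimate relies
    on uniqueness: it commutes with its exponential [1 + E], hence with the
    solution constructed in [expm_near1]. *)
Lemma logm_near1 (E : 'M[C]_n.+1) : l1norm E <= 1 / 8 ->
  is_principal_log (1 + E) (logm (1 + E)) /\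
  l1norm (logm (1 + E) - E) <= 8 * l1norm E ^+ 2.
Proof.
move=> E8; have [B [eB B2 BE cB]] := expm_near1 E8.
have plB : is_principal_log (1 + E) B.
  split=> // l /eigenvalue_le lB.
  have := pi_ge2 R; have := le_trans (cnorm_Im l) lB; rewrite ler_norml.
  by move=> /andP[h1 h2] p2; apply/andP; split; lra.
have plL : is_principal_log (1 + E) (logm (1 + E)) by apply: xgetPex; exists B.
suff -> : logm (1 + E) = B by [].
apply: (principal_log_unique plL plB); apply: cB.
have := comm_expm (erefl (logm (1 + E) *m logm (1 + E))).
by rewrite plL.1 !mulmxE mulrDr mulrDl mulr1 mul1r => /addrI.
Qed.

End near1.

(** * The inner product of L^2 *)

Section L2_dot.
Context d (T : measurableType d) (R : realType) (mu : {measure set T -> \bar R}).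
Implicit Types u v w : L2 mu.

Lemma L2_mul_integrable u v :
  mu.-integrable setT (EFin \o (fun x => L2_fun u x * L2_fun v x)).
Proof.
by apply/Lfun1_integrable; apply: Lfun2_mul_Lfun1; exact: L2_funP.
Qed.

Lemma measurable_L2_mul u v :
  measurable_fun setT (fun x => L2_fun u x * L2_fun v x).
Proof. by apply: measurable_funM; exact: measurable_L2_fun. Qed.

Lemma L2_dotDl u v w : L2_dot (u + v) w = L2_dot u w + L2_dot v w.
Proof.
rewrite /L2_dot -RintegralD//; [|exact: L2_mul_integrable..].
congr fine; apply: ae_eq_integral => //.
- by apply/measurable_EFinP; exact: measurable_L2_mul.
- apply/measurable_EFinP; apply: measurable_funD; exact: measurable_L2_mul.
- have := L2_funD u v; apply: filterS => x /(_ I) h _ /=.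
  by rewrite h /= !fctE mulrDl.
Qed.

Lemma L2_dotZl a u w : L2_dot (a *: u) w = a * L2_dot u w.
Proof.
rewrite /L2_dot -RintegralZl//; last exact: L2_mul_integrable.
congr fine; apply: ae_eq_integral => //.
- by apply/measurable_EFinP; exact: measurable_L2_mul.
- apply/measurable_EFinP; apply: measurable_funM => //.
  exact: measurable_L2_mul.
- have := L2_funZ a u; apply: filterS => x /(_ I) h _ /=.
  by rewrite h /= fctE -mulrA.
Qed.

Lemma L2_dotNl u w : L2_dot (- u) w = - L2_dot u w.
Proof. by rewrite -scaleN1r L2_dotZl mulN1r. Qed.

Lemma L2_dotBl u v w : L2_dot (u - v) w = L2_dot u w - L2_dot v w.
Proof. by rewrite L2_dotDl L2_dotNl. Qed.

Lemma L2_dot_suml (I : Type) (r : seq I) (F : I -> L2 mu) w :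
  L2_dot (\sum_(i <- r) F i) w = \sum_(i <- r) L2_dot (F i) w.
Proof.
elim: r => [|i r IH]; last by rewrite !big_cons L2_dotDl IH.
by rewrite !big_nil -(scale0r (0 : L2 mu)) L2_dotZl mul0r.
Qed.

(** The Cauchy-Schwarz inequality, as the case p = q = 2 of Hoelder's. *)
Lemma L2_dot_le u v : `|L2_dot u v| <= `|u| * `|v|.
Proof.
apply: (le_trans (le_normr_Rintegral measurableT (L2_mul_integrable u v))).
have fin w : ('N[mu]_(2%:R)%:E[EFin \o L2_fun w] \is a fin_num)%E.
  have /andP[_] := L2_funP w; rewrite inE /= => h.
  by rewrite ge0_fin_numE// Lnorm_ge0.
have -> : `|u| * `|v| =
    fine ('N[mu]_(2%:R)%:E[EFin \o L2_fun u] * 'N[mu]_(2%:R)%:E[EFin \o L2_fun v])%E.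
  by rewrite fineM.
have H := @hoelder _ _ _ mu (L2_fun u) (L2_fun v) 2 2
  (measurable_L2_fun u) (measurable_L2_fun v) (ltr0n _ 2) (ltr0n _ 2).
have {H}H := H ltac:(by rewrite [RHS]splitr !div1r).
rewrite Lnorm1 in H.
apply: fine_le H; last by rewrite fin_numM.
rewrite ge0_fin_numE ?integral_ge0//.
by have /integrableP[_] := L2_mul_integrable u v.
Qed.

Lemma cvg_L2_dot (S : Type) (F : set_system S) {FF : Filter F} (f : S -> L2 mu)
    (l w : L2 mu) :
  f @ F --> l -> L2_dot (f t) w @[t --> F] --> L2_dot l w.
Proof.
move=> fl; apply/subr_cvg0/norm_cvg0P.
have H : `|f t - l| * `|w| @[t --> F] --> (0 : R).
  rewrite -(mul0r `|w|); apply: cvgM; last exact: cvg_cst.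
  by apply/norm_cvg0P/subr_cvg0.
apply: (squeeze_cvgr _ (cvg_cst (0 : R)) H); apply: nearW => t.
by rewrite normr_ge0 -L2_dotBl L2_dot_le.
Qed.

End L2_dot.

(** * The Moore-Penrose inverse of a matrix of full column rank *)

Section pseudoinverse.
Variables (R : realType) (m n : nat).
Local Notation C := (Cplx R).
Local Open Scope sesquilinear_scope.
Implicit Types A : 'M[C]_(m, n).

Lemma adjmxM p q r (A : 'M[C]_(p, q)) (B : 'M[C]_(q, r)) :
  (A *m B)^t* = B^t* *m A^t*.
Proof. by rewrite trmx_mul map_mxM. Qed.

Lemma gram_eq0 (x : 'rV[C]_m) : x *m x^t* = 0 -> x = 0.
Proof.
move=> /matrixP /(_ ord0 ord0); rewrite !mxE => x0.
apply/rowP => j; rewrite mxE; apply/eqP; rewrite -normr_eq0 -sqrf_eq0 normCK.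
have s0 : \sum_j x ord0 j * (x ord0 j)^* = 0.
  by rewrite -[RHS]x0; apply: eq_bigr => k _; rewrite !mxE.
by apply/eqP/(psumr_eq0P _ s0) => // k _; rewrite -normCK exprn_ge0.
Qed.

Lemma gram_unit A : row_free A^T -> A^t* *m A \in unitmx.
Proof.
move=> fA; rewrite -row_free_unit; apply: inj_row_free => v vA.
have fA' : row_free (A^t* ) by rewrite row_free_map.
apply/eqP; rewrite -(mul_mx_rowfree_eq0 v fA'); apply/eqP; apply: gram_eq0.
by rewrite adjmxM trmxCK mulmxA -(mulmxA v) vA mul0mx.
Qed.

(** [(A^* A)^-1 A^*] satisfies the Penrose conditions; the first of them alone,
    [A A^+ A = A], then gives [A^+ A = 1] for any choice of [A^+], as [A] is
    injective. *)
Lemma mp_inverse_left A : row_free A^T -> mp_inverse A *m A = 1%:M.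
Proof.
move=> fA; have uG := gram_unit fA; set G := A^t* *m A in uG.
have GG : G^t* = G by rewrite adjmxM trmxCK.
have [AXA _ _ _] : is_mp_inverse A (mp_inverse A).
  apply: xgetPex; exists (invmx G *m A^t*); split.
  - by rewrite -!mulmxA mulVmx// mulmx1.
  - by rewrite -(mulmxA (invmx G)) -/G mulVmx// mul1mx.
  - by rewrite !adjmxM trmxCK trmx_inv map_invmx GG mulmxA.
  - by rewrite -mulmxA mulVmx// trmx1 map_mx1.
apply: (can_inj (@trmxK _ _ _)); apply: (row_free_inj fA).
by rewrite /= -!trmx_mul mulmxA AXA mulmx1.
Qed.

End pseudoinverse.

(** * The derivative at 0 of the logarithm along a curve through 1 *)

Section log_derivative.
Variables (R : realType) (n : nat).
Local Notation C := (Cplx R).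

(** If [E t / t] tends to [M], then [log (1 + E t) / t] is defined for small [t]
    and tends to [M] as well: the error is at most
    [8 * l1norm (E t) ^ 2 / t = 8 * l1norm (E t) * l1norm (E t / t)]. *)
Lemma log_derivative (E : R -> 'M[C]_n.+1) (M : 'M[C]_n.+1) :
  ((t%:C)%C : C)^-1 *: E t @[t --> 0^'+] --> M ->
  (\forall t \near 0^'+, exists B, is_principal_log (1 + E t) B) /\
  ((t%:C)%C : C)^-1 *: logm (1 + E t) @[t --> 0^'+] --> M.
Proof.
move=> EM.
have /cvg_l1normP EM0 := EM.
have t0 : t @[t --> (0 : R)^'+] --> (0 : R) by exact: cvg_at_right_filter.
have NE t : 0 < t -> l1norm (E t) = t * l1norm (((t%:C)%C : C)^-1 *: E t).
  move=> tp; rewrite l1normZ cnormV cnormr gtr0_norm// mulrA divff ?mul1r//.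
  exact: lt0r_neq0.
have bnd t : l1norm (((t%:C)%C : C)^-1 *: E t) <=
    l1norm (((t%:C)%C : C)^-1 *: E t - M) + l1norm M.
  by rewrite -{1}(subrK M (_ *: _)) l1normD.
have E0 : l1norm (E t) @[t --> 0^'+] --> (0 : R).
  have H : t * (l1norm (((t%:C)%C : C)^-1 *: E t - M) + l1norm M)
      @[t --> 0^'+] --> (0 : R).
    rewrite -[X in _ --> X](mul0r (0 + l1norm M)); apply: cvgM => //.
    by apply: cvgD => //; exact: cvg_cst.
  apply: cvg0_le H; near=> t.
  have tp : 0 < t by near: t; exact: nbhs_right_gt.
  by rewrite l1norm_ge0 NE// ler_wpM2l// ltW.
have E8 : \forall t \near 0^'+, l1norm (E t) <= 1 / 8.
  have /cvgrPdist_le /(_ (1 / 8)) := E0; rewrite divr_gt0// => /(_ isT).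
  by apply: filterS => t; rewrite sub0r normrN ger0_norm ?l1norm_ge0.
split.
  by apply: filterS E8 => t /logm_near1[H _]; exists (logm (1 + E t)).
apply/cvg_l1normP.
have H : 8 * l1norm (E t) * (l1norm (((t%:C)%C : C)^-1 *: E t - M) + l1norm M) +
     l1norm (((t%:C)%C : C)^-1 *: E t - M) @[t --> 0^'+] --> (0 : R).
  rewrite -[X in _ --> X](_ : 8 * 0 * (0 + l1norm M) + 0 = 0); last first.
    by rewrite mulr0 mul0r addr0.
  apply: cvgD => //; apply: cvgM.
    by apply: cvgM => //; exact: cvg_cst.
  by apply: cvgD => //; exact: cvg_cst.
apply: cvg0_le H; near=> t.
have tp : 0 < t by near: t; exact: nbhs_right_gt.
have te : l1norm (E t) <= 1 / 8 by near: t.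
rewrite l1norm_ge0 /=.
rewrite -(subrK (((t%:C)%C : C)^-1 *: E t) (_ *: logm _)) -addrA.
rewrite (le_trans (l1normD _ _))// lerD2r -scalerBr l1normZ.
have [_ LE] := logm_near1 te.
apply: (@le_trans _ _ (cnorm ((t%:C)%C : C)^-1 * (8 * l1norm (E t) ^+ 2))).
  by rewrite ler_wpM2l ?cnorm_ge0.
apply: (@le_trans _ _ (8 * l1norm (E t) * l1norm (((t%:C)%C : C)^-1 *: E t))).
  by rewrite l1normZ expr2 le_eqVlt; apply/orP; left; apply/eqP; ring.
by rewrite ler_wpM2l ?bnd// mulr_ge0// l1norm_ge0.
Unshelve. all: by end_near. Qed.

End log_derivative.

(** * Derivatives along trajectories and convergence of the generator matrix *)

Lemma at_right_within_dnbhs (R : realType) (A : set R) :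
  (within [set s : R | 0 <= s] (0 : R)^') A -> (0 : R)^'+ A.
Proof.
apply: (@filterS _ (nbhs (0 : R))) => s /= As s0.
by apply: As; rewrite ?gt_eqF// ltW.
Qed.

Lemma classical_solution_derive0 (R : realType) (U : normedModType R)
    (D : set U) (W : U -> U) (x : R -> U) (x0 : U) :
  classical_solution D W x x0 ->
  s^-1 *: (x s - x0) @[s --> (0 : R)^'+] --> W x0.
Proof.
move=> [<- _ /(_ 0 (lexx 0)) H _].
have : (s - 0)^-1 *: (x s - x 0) @[s --> (0 : R)^'+] --> W (x 0).
  by move=> A /H; exact: at_right_within_dnbhs.
by under eq_fun do rewrite subr0.
Qed.

(** Along a trajectory, the functional [<., w>] has the derivative [<W(.), w>]. *)
Lemma cvg_lie_quotient_dot d (T : measurableType d) (R : realType)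
    (mu : {measure set T -> \bar R}) (D : set (L2 mu)) (W : L2 mu -> L2 mu)
    (phi : R -> L2 mu -> L2 mu) (w v : L2 mu) :
  classical_solution D W (phi^~ v) v ->
  lie_quotient phi (fun v => ((L2_dot v w)%:C)%C) v s @[s --> 0^'+] -->
  (((L2_dot (W v) w)%:C)%C : Cplx R).
Proof.
move=> /classical_solution_derive0 H; apply/cvg_cnormP.
have H1 : L2_dot (s^-1 *: (phi s v - v)) w @[s --> 0^'+] --> L2_dot (W v) w.
  exact: cvg_L2_dot.
have H2 : `|L2_dot (s^-1 *: (phi s v - v)) w - L2_dot (W v) w| @[s --> 0^'+]
    --> (0 : R).
  by apply/norm_cvg0P/subr_cvg0.
apply: cvg0_le H2; apply: nearW => s; rewrite cnorm_ge0 /=.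
rewrite L2_dotZl L2_dotBl /lie_quotient /koopman /=.
by rewrite -cnormr !rmorphB rmorphM rmorphB fmorphV lexx.
Qed.

Unset Implicit Arguments.

Theorem proposition1 (R : realType) (p n m : nat)
    (X : set 'rV[R]_p.+1) (cX : compact X)
    (c : 'I_n.+1 -> R)
    (D : 'I_n.+1 -> set (L2_on cX)) (W : 'I_n.+1 -> L2_on cX -> L2_on cX)
    (DW Ubar : set (L2_on cX)) (phi : R -> L2_on cX -> L2_on cX)
    (w : L2_on cX) (u : 'I_m -> L2_on cX) :
  let zeta := fun i => observable (W i) w in
  D ord0 = setT -> (forall v, W ord0 v = v) ->
  (forall v, DW v -> forall i, c i != 0 -> D i v) ->
  semiflow phi ->
  generates DW (fun v => \sum_i c i *: W i v) phi ->
  Ubar `<=` DW -> flow_invariant phi Ubar ->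
  (forall i, Ubar `<=` D i) ->
  (forall i, Cb Ubar (zeta i)) ->
  span_on Ubar zeta `<=` lie_domain phi Ubar ->
  (forall k, Ubar (u k)) ->
  (n.+1 <= m)%N ->
  row_free (data_matrix zeta u)^T ->
  (\forall ts \near 0^'+,
     exists B, is_principal_log (koopman_matrix phi zeta u ts) B) /\
  forall i, generator_matrix phi zeta u ts i ord0 @[ts --> 0^'+]
    --> (((c i)%:C)%C : Cplx R).
Proof.
move=> zeta _ W0 _ _ gen UD _ _ _ spanL Uu _ rf.
pose T1 := data_matrix zeta u.
pose T2 t := data_matrix zeta (fun k => phi t (u k)).
pose P := mp_inverse T1.
have PT1 : P *m T1 = 1%:M by exact: mp_inverse_left.
pose Lam : 'M[Cplx R]_(m, n.+1) := \matrix_(k, i) lie_generator phi (zeta i) (u k).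
(* [zeta i] is the element of the span with the coefficients of the i-th unit
   vector. *)
have cLam k i : lie_quotient phi (zeta i) (u k) t @[t --> 0^'+] --> Lam k i.
  have /spanL[_ H _] : span_on Ubar zeta (zeta i).
    exists (fun j => (j == i)%:R) => v _.
    rewrite (bigD1 i)//= eqxx mul1r big1 ?addr0// => j /negbTE ->.
    by rewrite mul0r.
  by rewrite mxE; exact: H (Uu k).
have cQ : ((t%:C)%C : Cplx R)^-1 *: (T2 t - T1) @[t --> 0^'+] --> Lam.
  apply: cvg_mx_entry => k i.
  rewrite (_ : (fun t => _) = lie_quotient phi (zeta i) (u k)); first exact: cLam.
  by apply/funext => t; rewrite !mxE.
pose E t := P *m (T2 t - T1).
have kE t : koopman_matrix phi zeta u t = 1 + E t.
  by rewrite /E mulmxBr PT1 addrC subrK.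
have cE : ((t%:C)%C : Cplx R)^-1 *: E t @[t --> 0^'+] --> P *m Lam.
  rewrite (_ : (fun t => _) = fun t => P *m (((t%:C)%C : Cplx R)^-1 *: (T2 t - T1))).
    exact: (cvg_mulmxl P cQ).
  by apply/funext => t; rewrite scalemxAr.
(* The first column of [Lam] is the image under [T1] of the coefficients [c]. *)
have Lam0 k : Lam k ord0 = \sum_i zeta i (u k) * ((c i)%:C)%C.
  have H := cvg_lie_quotient_dot (w := w) (gen _ (UD _ (Uu k))).
  have zeta0 : zeta ord0 = fun v => ((L2_dot v w)%:C)%C.
    by apply/funext => v; rewrite /zeta /observable W0.
  have := cLam k ord0; rewrite zeta0 => HL.
  rewrite (cvg_unique (@norm_hausdorff _ _) HL H).
  rewrite L2_dot_suml rmorph_sum; apply: eq_bigr => j _.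
  by rewrite L2_dotZl rmorphM mulrC.
have PLam0 i : (P *m Lam) i ord0 = ((c i)%:C)%C.
  have -> : (P *m Lam) i ord0 = (P *m T1 *m \col_j ((c j)%:C)%C) i ord0.
    rewrite -mulmxA mxE [RHS]mxE; apply: eq_bigr => k _; rewrite Lam0 mxE.
    by congr (_ * _); apply: eq_bigr => j _; rewrite !mxE.
  by rewrite PT1 mul1mx mxE.
have [ex lim] := log_derivative cE.
split; first by apply: filterS ex => t; rewrite kE.
move=> i; rewrite -PLam0.
have : (((t%:C)%C : Cplx R)^-1 *: logm (1 + E t)) i ord0 @[t --> 0^'+]
    --> (P *m Lam) i ord0.
  apply: (cvg_comp _ (fun M : 'M[Cplx R]_n.+1 => M i ord0) lim).
  exact: coord_continuous.
have -> // : (fun ts => generator_matrix phi zeta u ts i ord0) =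
  fun t => (((t%:C)%C : Cplx R)^-1 *: logm (1 + E t)) i ord0.
by apply/funext => t; rewrite /generator_matrix kE.
Qed.
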